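(* Let $K$ be a field, let $S=K[t_1,\ldots,t_s]$ with the standard grading, let $I\subset S$ be a nonzero graded ideal with $\dim(S/I)\geq 1$, and let $\prec$ be a monomial order on $S$. If ${\rm in}_\prec(I)$ is a complete intersection of height $r$ generated by monomials $t^{\alpha_1},\ldots,t^{\alpha_r}$ with $d_i=\deg(t^{\alpha_i})$ and $1\leq d_i\leq d_{i+1}$ for $i\geq 1$, then $\delta_I(d)\geq{\rm fp}_I(d)\geq 1$ for all $d\geq 1$, and the footprint function is given by $${\rm fp}_I(d)=\begin{cases}(d_{k+1}-\ell)\,d_{k+2}\cdots d_r&\text{if } 1\leq d\leq\sum_{i=1}^{r}(d_i-1)-1,\\ 1&\text{if } d\geq\sum_{i=1}^{r}(d_i-1),\end{cases}$$ where, in the first case, $0\leq k\leq r-1$ and $\ell$ are integers such that $d=\sum_{i=1}^{k}(d_i-1)+\ell$ and $1\leq\ell\leq d_{k+1}-1$ (and $d_{k+2}\cdots d_r=1$ if $k=r-1$).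
   Context: For $a=(a_1,\ldots,a_s)\in\mathbb{N}^s$, $t^a=t_1^{a_1}\cdots t_s^{a_s}$. An ideal $J$ is a complete intersection if it can be generated by ${\rm ht}(J)$ elements. $S=\bigoplus_{d\ge 0}S_d$ is the standard graded polynomial ring and $\mathbb{N}_+$ is the set of positive integers. For a proper graded ideal $J$ of $S$ with $k=\dim(S/J)$ (Krull dimension) and Hilbert function $H_J(d)=\dim_K(S_d/J_d)$, the degree (multiplicity) is $\deg(S/J)=(k-1)!\lim_{d\to\infty}H_J(d)/d^{k-1}$ if $k\geq 1$ and $\deg(S/J)=\dim_K(S/J)$ if $k=0$. $(J\colon f)=\{h\in S: hf\in J\}$. For $d\geq 1$, let $\mathcal{F}_d=\{f\in S_d: f\notin I,\ (I\colon f)\neq I\}$. The minimum distance function $\delta_I\colon\mathbb{N}_+\to\mathbb{Z}$ of $I$ is $\delta_I(d)=\deg(S/I)-\max\{\deg(S/(I,f)): f\in\mathcal{F}_d\}$ if $\mathcal{F}_d\neq\emptyset$, and $\delta_I(d)=\deg(S/I)$ if $\mathcal{F}_d=\emptyset$. ${\rm in}_\prec(I)$ is the initial ideal of $I$. Let $\mathcal{M}_{\prec,d}$ be the set of monomials $t^a\in S_d$ with $t^a\notin{\rm in}_\prec(I)$ and $({\rm in}_\prec(I)\colon t^a)\neq{\rm in}_\prec(I)$. The footprint function ${\rm fp}_I\colon\mathbb{N}_+\to\mathbb{Z}$ of $I$ (with respect to $\prec$) is ${\rm fp}_I(d)=\deg(S/I)-\max\{\deg(S/({\rm in}_\prec(I),t^a)):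 t^a\in\mathcal{M}_{\prec,d}\}$ if $\mathcal{M}_{\prec,d}\neq\emptyset$, and ${\rm fp}_I(d)=\deg(S/I)$ if $\mathcal{M}_{\prec,d}=\emptyset$. *)

(* Defs.v *)
(* Ideals are Prop-valued sets of polynomials: the ideals of ring_quotient are
   proper and decidable, whereas (I, f), (I : f) and in(I) are built here from
   an arbitrary ideal.  Numerical invariants are natural numbers given by
   supremum, infimum or xget, with 0 as junk value (when the set is empty or
   unbounded, or the quantity does not exist). *)
From HB Require Import structures.
From mathcomp Require Import all_boot all_order all_algebra.
From mathcomp.multinomials Require Export mpoly.
From mathcomp Require Export boolp classical_sets.
From mathcomp Require Import topology normedtype sequences.

Set Implicit Arguments.
Unset Strict Implicit.
Unset Printing Implicit Defensive.

Import Order.TTheory GRing.Theory Num.Theory.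
Import numFieldNormedType.Exports.
Local Open Scope classical_set_scope.
Local Open Scope ring_scope.

Section Ideals.
Variable R : comNzRingType.
Implicit Types I J P : set R.

Definition is_ideal I : Prop :=
  [/\ I 0, (forall f g, I f -> I g -> I (f + g))
    & (forall h f, I f -> I (h * f))].

Definition ideal_gen (G : set R) : set R :=
  [set f | exists (m : nat) (c g : 'I_m -> R),
     (forall i, G (g i)) /\ f = \sum_(i < m) c i * g i].

Definition add_gen I (f : R) : set R := ideal_gen (I `|` [set f]).

Definition colon I (f : R) : set R := [set h | I (h * f)].

Definition is_prime P : Prop :=
  [/\ is_ideal P, ~ P 1 & forall f g, P (f * g) -> P f \/ P g].

(* p_0 < p_1 < ... < p_m: length m, hence m.+1 primes. *)
Definition prime_chain m (p : 'I_m.+1 -> set R) : Prop :=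
  (forall i, is_prime (p i)) /\
  (forall i j : 'I_m.+1, (i < j)%N -> p i `<` p j).

(* The Krull dimension of R/J; the primes of R/J are the P/J with P a prime of
   R containing J. *)
Definition dim_quot J : nat :=
  supremum 0%N [set m | exists p : 'I_m.+1 -> set R,
    prime_chain p /\ J `<=` p ord0].

Definition prime_height P : nat :=
  supremum 0%N [set m | exists p : 'I_m.+1 -> set R,
    prime_chain p /\ p ord_max = P].

Definition height J : nat :=
  infimum 0%N [set prime_height P | P in [set P | is_prime P /\ J `<=` P]].

Definition complete_intersection J : Prop :=
  exists g : 'I_(height J) -> R, J = ideal_gen (range g).

End Ideals.

Section QuotDim.
Variables (K : fieldType) (V : lmodType K).

(* For subspaces W <= U: the classes mod W of the b i form a basis of U/W. *)
Definition quot_basis (U W : set V) m (b : 'I_m -> V) : Prop :=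
  [/\ forall i, U (b i),
      forall c : 'I_m -> K, W (\sum_(i < m) c i *: b i) -> forall i, c i = 0
    & forall v, U v -> exists c : 'I_m -> K, W (v - \sum_(i < m) c i *: b i)].

Definition quot_dim (U W : set V) : nat :=
  xget 0%N [set m | exists b : 'I_m -> V, quot_basis U W b].

End QuotDim.

Section Footprint.
(* S = K[t_1, ..., t_s]; a : 'X_{1..s} is an exponent vector and 'X_[a] = t^a. *)
Variables (K : fieldType) (s : nat).
Local Notation S := {mpoly K[s]}.
Implicit Types I J : set S.

Definition graded I : Prop :=
  forall f, I f -> forall d, I (pihomog mdeg d f).

Definition homog_part (d : nat) : set S := [set f | f \is d.-homog].

Definition hilbert J (d : nat) : nat :=
  quot_dim (homog_part d) (J `&` homog_part d).

(* The limit is a natural number by Hilbert's theorem, so it may be taken in the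
   rationals; rat^o carries the topology of the absolute value. *)
Definition degree J : nat :=
  if dim_quot J is k.+1
  then xget 0%N [set e : nat |
         (fun d : nat => (k`!)%:R * (hilbert J d)%:R / d%:R ^+ k : rat^o)
           @ \oo --> (e%:R : rat^o)]
  else quot_dim [set: S] J.

Definition zero_div_forms I (d : nat) : set S :=
  [set f | [/\ f \is d.-homog, ~ I f & colon I f <> I]].

(* A supremum in nat of a nonempty bounded set is its maximum. *)
Definition min_dist I (d : nat) : int :=
  if zero_div_forms I d == set0 then (degree I)%:Z
  else (degree I)%:Z -
       (supremum 0%N [set degree (add_gen I f) | f in zero_div_forms I d])%:Z.

(* [le a b] means that t^a precedes or equals t^b. *)
Definition monomial_order (le : rel 'X_{1..s}) : Prop :=
  [/\ antisymmetric le, transitive le, total le,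
      (forall a, le 0%MM a)
    & (forall a b c, le a b -> le (a + c)%MM (b + c)%MM)].

Definition is_lead (le : rel 'X_{1..s}) (f : S) (a : 'X_{1..s}) : Prop :=
  a \in msupp f /\ forall b, b \in msupp f -> le b a.

Definition initial_ideal (le : rel 'X_{1..s}) I : set S :=
  ideal_gen [set g | exists f a, [/\ I f, is_lead le f a & g = 'X_[a]]].

Definition zero_div_monomials (le : rel 'X_{1..s}) I (d : nat) :
    set 'X_{1..s} :=
  let J := initial_ideal le I in
  [set a | [/\ mdeg a = d, ~ J 'X_[a] & colon J 'X_[a] <> J]].

Definition footprint (le : rel 'X_{1..s}) I (d : nat) : int :=
  if zero_div_monomials le I d == set0 then (degree I)%:Z
  else (degree I)%:Z -
       (supremum 0%N [set degree (add_gen (initial_ideal le I) 'X_[a])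
                     | a in zero_div_monomials le I d])%:Z.

End Footprint.

(* Main.v *)
Require Import Defs.
From mathcomp Require Import all_boot all_order all_algebra zify ring.
From mathcomp Require Import topology normedtype sequences.

(** The Hilbert function of a graded ideal J counts the monomials that are not
    leading monomials of J ([hilbert_count]), so I and in(I) have the same one.
    Everything is therefore reduced to counting monomials, except for the Krull
    dimensions in the definition of the degree and for the height of in(I).

    Dimension.  A chain of primes of length m above J yields m elements that are
    algebraically independent modulo J ([chain_indep]), hence a Hilbert function
    of growth at least n ^ m.  Conversely, if j variables are such that no leading
    monomial of J involves only them, a graded ideal above J that is maximal with
    a set of j such variables is prime, and adding a variable to it lowers j by
    at most one ([free_chain]).  So dim S/J is the largest such j ([dim_quotE]).

    Generators.  The same bound on chains shows that a prime generated by n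
    variables has height at most n.  If two of the r generators of in(I) shared a
    variable, r - 1 variables would meet all of them and in(I) would have height
    less than r; thus their supports are disjoint ([disjoint_supports]), and the
    Hilbert series of in(I) is the product of the 1 + T + ... + T ^ (d_i - 1)
    divided by (1 - T) ^ (s - r) ([degree_count_disjoint]).  Hence S/I has degree
    d_1 ... d_r.  A monomial t^a outside in(I) divides zero modulo in(I) exactly
    when it shares a variable with some generator.  As the colon of in(I) by t^a
    is generated by the t^(alpha_i - a), with truncated subtraction, the degree of
    S/(in(I), t^a) is d_1 ... d_r - x_1 ... x_r, where x_i = deg(alpha_i - a)
    ([degree_add]).

    Footprint.  So fp_I(d) is the minimum of the products x_1 ... x_r, where
    1 <= x_i <= d_i and the d_i - x_i add up to at most d.  An exchange argument
    shows that the best choice lowers the smallest factors first ([greedy_min]),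
    which gives the formula, and this choice comes from a monomial of degree d
    since dim S/I >= 1 leaves room to reach the degree d ([residual_attained]).

    Minimum distance.  A form f of degree d that divides zero modulo I can be
    reduced modulo I to one with leading monomial t^a outside in(I), and t^a then
    divides zero modulo in(I) ([zero_div_lead]).  Since in(I, f) contains in(I) and
    t^a, the Hilbert function of (I, f) is at most that of (in(I), t^a).  Both
    quotients have dimension s - r ([free_forms]), so their degrees compare in the
    same way, and delta_I(d) >= fp_I(d). *)

Set Implicit Arguments.
Unset Strict Implicit.
Unset Printing Implicit Defensive.

Import Order.TTheory GRing.Theory Num.Theory.
Import numFieldNormedType.Exports.
Local Open Scope classical_set_scope.
Local Open Scope ring_scope.

(** * Linear algebra modulo a subspace *)

Section LinearAlgebra.
Variables (K : fieldType) (V : lmodType K).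
Implicit Types (U W : set V).

Definition subspace W : Prop :=
  [/\ W 0, forall u v, W u -> W v -> W (u + v) & forall c v, W v -> W (c *: v)].

Definition indep_mod W (I : finType) (b : I -> V) : Prop :=
  forall c : I -> K, W (\sum_i c i *: b i) -> forall i, c i = 0.

Lemma subspaceB W u v : subspace W -> W u -> W v -> W (u - v).
Proof. by case=> _ WD WZ Wu Wv; rewrite -scaleN1r; apply/WD/WZ. Qed.

Lemma subspace_sum W (I : Type) (r : seq I) (P : pred I) (F : I -> V) :
  subspace W -> (forall i, P i -> W (F i)) -> W (\sum_(i <- r | P i) F i).
Proof. by case=> W0 WD _ WF; apply: big_ind. Qed.

Lemma indep_le_span W (I J : finType) (b : I -> V) (c : J -> V) :
    subspace W -> indep_mod W b ->
    (forall i, exists a : J -> K, W (b i - \sum_j a j *: c j)) ->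
  (#|I| <= #|J|)%N.
Proof.
move=> sW indb /choice[a Wa].
pose A := \matrix_(i < #|I|, j < #|J|) a (enum_val i) (enum_val j).
suff: row_free A by move/eqP <-; exact: rank_leq_col.
apply: inj_row_free => v vA0.
pose e i := v 0 (enum_rank i).
suff e0 : forall i, e i = 0.
  by apply/rowP => i; rewrite mxE -(e0 (enum_val i)) /e enum_valK.
apply: indb; have [_ WD WZ] := sW.
have -> : \sum_i e i *: b i = \sum_i e i *: (b i - \sum_j a i j *: c j).
  apply/esym; under eq_bigr do rewrite scalerBr; rewrite sumrB.
  suff -> : \sum_i e i *: (\sum_j a i j *: c j) = 0 by rewrite subr0.
  under eq_bigr do rewrite scaler_sumr.
  rewrite exchange_big big1 //= => j _.
  under eq_bigr do rewrite scalerA.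
  rewrite -scaler_suml.
  suff -> : \sum_i e i * a i j = (v *m A) 0 (enum_rank j).
    by rewrite vA0 mxE scale0r.
  rewrite mxE (reindex (fun i : 'I_#|I| => enum_val i)) /=; last exact/onW_bij/enum_val_bij.
  by apply: eq_bigr => i _; rewrite mxE /e enum_valK enum_rankK.
by apply: subspace_sum => // i _; apply: WZ.
Qed.

Lemma quot_dim_unique U W m (b : 'I_m -> V) :
  subspace W -> quot_basis U W b -> quot_dim U W = m.
Proof.
move=> sW basb; apply: xget_unique => [|m' [b' [Ub' ib' sb']]]; first by exists b.
have [Ub ib sb] := basb; apply/eqP; rewrite eqn_leq.
have le1 := indep_le_span sW ib' (fun i => sb _ (Ub' i)).
have le2 := indep_le_span sW ib (fun i => sb' _ (Ub i)).
by rewrite !card_ord in le1 le2; rewrite le1.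
Qed.

End LinearAlgebra.

(** * Standard monomials and Hilbert functions *)

Section Monomials.
Variables (K : fieldType) (s : nat).
Local Notation S := {mpoly K[s]}.
Local Notation mon := 'X_{1..s}.

Lemma ideal_subspace (J : set S) : is_ideal J -> subspace J.
Proof. by case=> J0 JD JM; split=> // c v Jv; rewrite -mul_mpolyC; apply: JM. Qed.

Lemma mcoeff_pihomog d (f : S) m :
  (pihomog mdeg d f)@_m = if mdeg m == d then f@_m else 0.
Proof.
rewrite [in RHS](mpolyE f) pihomogE !raddf_sum /= big_mkcond /=.
case: ifP => [/eqP md|md]; last first.
  apply: big1 => a _; case: ifP => // /eqP ad.
  rewrite mcoeffZ mcoeffX; case: eqP => [am|_]; last by rewrite mulr0.
  by rewrite -am ad eqxx in md.
apply: eq_bigr => a _; case: ifP => // ad; rewrite mcoeffZ mcoeffX.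
case: eqP => [am|_]; last by rewrite mulr0.
by rewrite am md eqxx in ad.
Qed.

Lemma mem_pihomog d (f : S) m :
  (m \in msupp (pihomog mdeg d f)) = (mdeg m == d) && (m \in msupp f).
Proof. by rewrite !mcoeff_msupp mcoeff_pihomog; case: (mdeg m == d); rewrite ?eqxx. Qed.

Lemma mcoeff_sum_monomials (L : seq mon) (c : 'I_(size L) -> K) m : uniq L ->
  (forall j : 'I_(size L), m = nth 0%MM L j ->
     (\sum_i c i *: 'X_[nth 0%MM L i])@_m = c j) /\
  (m \notin L -> (\sum_i c i *: 'X_[nth 0%MM L i])@_m = 0).
Proof.
move=> uL; rewrite raddf_sum /=; split=> [j mj|mL].
  rewrite (bigD1 j) //= mcoeffZ mcoeffX mj eqxx mulr1 big1 ?addr0 // => i ij.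
  by rewrite mcoeffZ mcoeffX nth_uniq // (inj_eq val_inj) (negPf ij) mulr0.
apply: big1 => i _; rewrite mcoeffZ mcoeffX; case: eqP => [im|]; rewrite ?mulr0 //.
by rewrite -im mem_nth in mL.
Qed.

Lemma msupp_sum_monomials (L : seq mon) (c : 'I_(size L) -> K) : uniq L ->
  {subset msupp (\sum_i c i *: 'X_[nth 0%MM L i]) <= L}.
Proof.
move=> uL m; apply: contraLR => mL; rewrite mcoeff_msupp negbK.
by rewrite (proj2 (mcoeff_sum_monomials c m uL)).
Qed.

Lemma mpoly_sum_monomials (L : seq mon) (f : S) : uniq L -> {subset msupp f <= L} ->
  f = \sum_(i < size L) f@_(nth 0%MM L i) *: 'X_[nth 0%MM L i].
Proof.
move=> uL fL; apply/mpolyP => m.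
have [cj c0] := mcoeff_sum_monomials (fun i : 'I_(size L) => f@_(nth 0%MM L i)) m uL.
case: (boolP (m \in L)) => mL; last first.
  by rewrite c0 //; apply/eqP; rewrite mcoeff_eq0; apply: contra mL => /fL.
have im : (index m L < size L)%N by rewrite index_mem.
by rewrite (cj (Ordinal im)) /= nth_index.
Qed.

Definition mons n : seq mon := [seq bmnm a | a <- enum {: 'X_{1..s < n}}].

Lemma mem_mons n a : (a \in mons n) = (mdeg a < n)%N.
Proof.
apply/mapP/idP => [[b _ ->]|an]; first exact: bmdeg.
by exists (BMultinom an); rewrite ?mem_enum.
Qed.

Lemma mons_uniq n : uniq (mons n).
Proof. by rewrite map_inj_uniq ?enum_uniq //; exact: val_inj. Qed.

(** The two Hilbert functions of the monomials outside M: cumulative, in the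
    degrees smaller than n, and in degree d. *)
Definition affine_count (M : set mon) n : nat :=
  size [seq a <- mons n | ~~ `[< M a >]].

Definition degree_count (M : set mon) d : nat :=
  size [seq a <- mons d.+1 | (mdeg a == d) && ~~ `[< M a >]].

Definition up_closed (M : set mon) : Prop := forall a b, M a -> M (a + b)%MM.

Section Order.
Variable le : rel mon.
Hypothesis hle : monomial_order le.

Let le_anti : antisymmetric le. Proof. by case: hle. Qed.
Let le_trans : transitive le. Proof. by case: hle. Qed.
Let le_total : total le. Proof. by case: hle. Qed.
Let le_refl : reflexive le. Proof. by move=> a; case/orP: (le_total a a). Qed.

Lemma le_add2 a b c d : le a b -> le c d -> le (a + c)%MM (b + d)%MM.
Proof.
case: hle => _ _ _ _ leD ab cd; apply: (le_trans (leD _ _ c ab)).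
by rewrite ![(b + _)%MM]addmC; exact: leD.
Qed.

Definition lead_mons (J : set S) : set mon :=
  [set a | exists2 f, J f & is_lead le f a].

Lemma exists_lead (f : S) : f != 0 -> exists a, is_lead le f a.
Proof.
rewrite -msupp_eq0 /is_lead.
suff max r : r != [::] -> exists a, a \in r /\ forall b, b \in r -> le b a.
  exact: max.
elim: r => // x [|y r] IH _.
  by exists x; split=> [|b]; rewrite inE // => /eqP ->.
have [//|a [ar amax]] := IH; case/orP: (le_total x a) => xa.
  exists a; split=> [|b]; first by rewrite inE ar orbT.
  by rewrite inE => /orP[/eqP -> //|]; exact: amax.
exists x; split=> [|b]; first exact: mem_head.
rewrite inE => /orP[/eqP -> //|/amax ba]; exact: le_trans xa.
Qed.

Lemma is_leadM (f g : S) a b :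
  is_lead le f a -> is_lead le g b -> is_lead le (f * g) (a + b)%MM.
Proof.
move=> [af fa] [bg gb].
suff cab : (f * g)@_(a + b)%MM = f@_a * g@_b.
  split; first by rewrite mcoeff_msupp cab mulf_neq0 // -mcoeff_msupp.
  move=> m /msuppM_le /allpairsP[[u v] /= [uf vg ->]].
  by apply: le_add2; [exact: fa | exact: gb].
have -> : f * g = \sum_(u <- msupp f) \sum_(v <- msupp g)
                   (f@_u * g@_v) *: 'X_[u + v].
  rewrite [in LHS](mpolyE f) [in LHS](mpolyE g) mulr_suml; apply: eq_bigr => u _.
  rewrite mulr_sumr; apply: eq_bigr => v _.
  by rewrite -scalerAl -scalerAr scalerA mpolyXD.
rewrite raddf_sum (bigD1_seq a) //= raddf_sum (bigD1_seq b) //=.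
rewrite mcoeffZ mcoeffX eqxx mulr1.
rewrite [X in _ + X + _]big_seq_cond big1 ?addr0; last first.
  move=> v /andP[_ vb]; rewrite mcoeffZ mcoeffX eqm_add2l (negPf vb); exact: mulr0.
rewrite big_seq_cond big1 ?addr0 // => u /andP[uf ua].
rewrite raddf_sum /= big_seq_cond big1 // => v /andP[vg _].
rewrite mcoeffZ mcoeffX; case: eqP => [uv|]; rewrite ?mulr0 //.
case/negP: ua; apply/eqP/le_anti; rewrite fa //=.
have vb := gb _ vg; case: hle => _ _ _ _ leD.
have := leD _ _ u vb; rewrite ![(_ + u)%MM]addmC uv => abu.
case/orP: (le_total a u) => // ua.
(* a + b <= u + b by maximality of b, and u + b <= a + b as u <= a. *)
have := leD _ _ b ua => uab.
have e : (u + b)%MM = (a + b)%MM by apply: le_anti; rewrite uab abu.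
by rewrite (addIm e).
Qed.

Lemma lead_mons_up (J : set S) : is_ideal J -> up_closed (lead_mons J).
Proof.
move=> [_ _ JM] a b [f Jf fa]; exists ('X_[b] * f); first exact: JM.
rewrite addmC; apply: is_leadM => //; split=> [|m]; first by rewrite msuppX inE.
by rewrite msuppX inE => /eqP ->.
Qed.

(** Only the elements of W supported on T count, so that everything happens in
    a finite-dimensional space. *)
Definition lead_in (W : set S) (T : seq mon) : set mon :=
  [set a | exists g, [/\ W g, {subset msupp g <= T} & is_lead le g a]].

Definition standard (W : set S) (T : seq mon) : seq mon :=
  [seq a <- T | ~~ `[< lead_in W T a >]].

Lemma standard_free (W : set S) T (h : S) :
  {subset msupp h <= standard W T} -> W h -> h = 0.
Proof.
move=> hT Wh; apply/eqP/negP => /negP/exists_lead[a ha].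
have := hT a ha.1; rewrite mem_filter => /andP[/asboolP + _]; apply.
by exists h; split=> // b /hT; rewrite mem_filter => /andP[].
Qed.

(** Division with remainder inside the span of the finite set T: the largest
    nonstandard monomial of f is cancelled again and again, which ends
    because only finitely many monomials of T, counted by [rk], lie below it. *)
Lemma standard_span (W : set S) T (f : S) : subspace W -> {subset msupp f <= T} ->
  exists h, {subset msupp h <= standard W T} /\ W (f - h).
Proof.
move=> sW; have [W0 WD WZ] := sW.
pose rk a := count (fun x => le x a && (x != a)) T.
have rk_lt a b : a \in T -> le a b -> a != b -> (rk a < rk b)%N.
  move=> aT ab nab; rewrite /rk.
  have := count_predUI (fun x => le x a && (x != a)) (pred1 a) T.
  rewrite (_ : count (predI _ _) T = 0%N) ?addn0; last first.
    rewrite -(count_pred0 T); apply: eq_count => x /=.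
    by case: eqP => [->|]; rewrite ?andbF // eqxx andbF.
  have : (0 < count_mem a T)%N by rewrite -has_count has_pred1.
  move=> a0 eU; rewrite -addn1 (leq_trans (leq_add (leqnn _) a0)) // -eU.
  apply: sub_count => x /= /orP[/andP[xa nxa]|/eqP -> ]; last by rewrite ab nab.
  rewrite (le_trans xa ab); apply: contraNneq nxa => xb.
  by apply/eqP/le_anti; rewrite xa xb ab.
move=> fT; have [n] : exists n, forall a, a \in msupp f -> lead_in W T a ->
    (rk a < n)%N.
  by exists (size T).+1 => a _ _; rewrite ltnS; exact: count_size.
elim: n f fT => [|n IH] f fT rkf.
  exists f; split; last by rewrite subrr.
  by move=> a af; rewrite mem_filter fT // andbT; apply/asboolP => /(rkf _ af).
have [[a [af [g [Wg gT [ag ga]]] rka]]|nex] :=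
  pselect (exists a, [/\ a \in msupp f, lead_in W T a & rk a = n]); last first.
  apply: IH => // a af la; have := rkf a af la; rewrite ltnS leq_eqVlt.
  by case/orP=> // /eqP rka; case: nex; exists a.
pose c := f@_a / g@_a; pose f' := f - c *: g.
have f'a : a \notin msupp f'.
  rewrite -mcoeff_eq0 mcoeffB mcoeffZ divfK ?subrr //.
  by rewrite -mcoeff_msupp.
have f'P b : b \in msupp f' -> b \in msupp f \/ b \in msupp g.
  move/msuppB_le; rewrite mem_cat => /orP[|/msuppZ_le]; by [left|right].
have f'T : {subset msupp f' <= T} by move=> b /f'P[/fT|/gT].
have [|h [hstd Wh]] := IH f' f'T; last first.
  exists h; split=> //; have -> : f - h = f' - h + c *: g.
    by rewrite /f'; ring.
  by apply/WD/WZ.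
move=> b bf' lb; rewrite -rka.
have nba : b != a by apply: contraNneq f'a => <-.
have bT := f'T b bf'; apply: (rk_lt) => //.
case/f'P: bf' => [bf|/ga //].
case/orP: (le_total a b) => // ab.
have := rkf b bf lb; have := rk_lt a b (fT _ af) ab; rewrite eq_sym nba rka.
by move=> /(_ isT); lia.
Qed.

Lemma graded_lead_in (J : set S) (T : seq mon) a : graded J ->
  (forall b, mdeg b = mdeg a -> b \in T) -> lead_mons J a -> lead_in J T a.
Proof.
move=> gJ aT [f Jf [af fa]]; exists (pihomog mdeg (mdeg a) f); split.
- exact: gJ.
- by move=> b; rewrite mem_pihomog => /andP[/eqP /aT].
- split; first by rewrite mem_pihomog eqxx.
  by move=> b; rewrite mem_pihomog => /andP[_ /fa].
Qed.

Lemma standard_mons (J : set S) n : graded J ->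
  standard J (mons n) = [seq a <- mons n | ~~ `[< lead_mons J a >]].
Proof.
move=> gJ; apply: eq_in_filter => a; rewrite mem_mons => an; congr (~~ _).
apply/asboolP/asboolP => [[g [Jg _ ga]]|]; first by exists g.
by apply: graded_lead_in => // b ba; rewrite mem_mons ba.
Qed.

(** The standard monomials of degree d are a basis of S_d / J_d. *)
Lemma hilbert_count (J : set S) d : is_ideal J -> graded J ->
  hilbert J d = degree_count (lead_mons J) d.
Proof.
move=> iJ gJ; pose T := [seq a <- mons d.+1 | mdeg a == d].
have memT a : (a \in T) = (mdeg a == d).
  by rewrite mem_filter mem_mons andb_idr // => /eqP ->.
have homT (f : S) : homog_part d f <-> {subset msupp f <= T}.
  split=> [/dhomogP fd a /fd /eqP|fT]; first by rewrite memT.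
  by apply/dhomogP => a /fT; rewrite memT => /eqP.
have uT : uniq T by rewrite filter_uniq ?mons_uniq.
have sJ := ideal_subspace iJ; have [J0 JD JZ] := sJ.
have sH : subspace (J `&` homog_part d).
  split=> [|u v [Ju hu] [Jv hv]|c v [Jv hv]].
  - by split=> //; exact: dhomog0.
  - by split; [exact: JD | exact: dhomogD].
  - by split; [exact: JZ | exact: dhomogZ].
set L := standard J T; have uL : uniq L by rewrite filter_uniq.
have LT : {subset L <= T} by move=> a; rewrite mem_filter => /andP[].
have -> : degree_count (lead_mons J) d = size L.
  rewrite /L /standard /T -filter_predI /degree_count; congr size.
  apply: eq_in_filter => a _ /=; rewrite andbC; case: eqP; rewrite ?andbF //= !andbT.
  move=> ad; congr (~~ _); apply/asboolP/asboolP => [|[g [Jg _ ga]]]; last by exists g.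
  by apply: graded_lead_in => // b ba; rewrite memT ba ad.
apply: (@quot_dim_unique _ _ _ _ _ (fun i => 'X_[nth 0%MM L i])) => //; split.
- move=> i; apply/homT => a; rewrite msuppX inE => /eqP ->; exact/LT/mem_nth.
- move=> c [Jc _] i.
  have /mpolyP/(_ (nth 0%MM L i)) := standard_free (@msupp_sum_monomials L c uL) Jc.
  by rewrite mcoeff0 (proj1 (mcoeff_sum_monomials c _ uL) i).
- move=> v Uv; have [h [hL Jh]] := standard_span sJ (proj1 (homT v) Uv).
  exists (fun i : 'I_(size L) => h@_(nth 0%MM L i)).
  rewrite -mpoly_sum_monomials //; split=> //.
  apply/homT => a /msuppB_le; rewrite mem_cat => /orP[/(proj1 (homT v) Uv) //|].
  by move/hL/LT.
Qed.

(** As J is graded, the polynomials of degree less than n are spanned modulo J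
    by the standard monomials of degree less than n. *)
Lemma indep_le_affine (J : set S) n (I : finType) (b : I -> S) :
    is_ideal J -> graded J -> indep_mod J b -> (forall i, msize (b i) <= n)%N ->
  (#|I| <= affine_count (lead_mons J) n)%N.
Proof.
move=> iJ gJ ib bn; have sJ := ideal_subspace iJ.
rewrite /affine_count -standard_mons //; set L := standard J (mons n).
have uL : uniq L by rewrite filter_uniq ?mons_uniq.
rewrite -[size L]card_ord.
apply: (indep_le_span (c := fun i : 'I_(size L) => 'X_[nth 0%MM L i]) sJ ib) => i.
have [|h [hL Jh]] := @standard_span J (mons n) (b i) sJ.
  by move=> a ai; rewrite mem_mons; apply: leq_trans (bn i); apply: msize_mdeg_lt.
by exists (fun i : 'I_(size L) => h@_(nth 0%MM L i)); rewrite -mpoly_sum_monomials.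
Qed.

End Order.
End Monomials.

(** * Sums and colons of ideals *)

Section Ideals.
Variable R : comNzRingType.
Implicit Types (G J : set R) (f g : R).

Lemma ideal_genS G J :
  is_ideal J -> G `<=` J -> ideal_gen G `<=` J.
Proof.
move=> [J0 JD JM] GJ f [m [c [g [Gg ->]]]].
by apply: big_ind => // i _; apply/JM/GJ.
Qed.

Lemma sub_ideal_gen G : G `<=` ideal_gen G.
Proof.
move=> f Gf; exists 1%N, (fun=> 1), (fun=> f); split=> //.
by rewrite big_ord1 mul1r.
Qed.

Lemma ideal_gen_ideal G : is_ideal (ideal_gen G).
Proof.
split.
- by exists 0%N, (fun=> 0), (fun=> 0); split=> [[]//|]; rewrite big_ord0.
- move=> _ _ [m [c [g [Gg ->]]]] [m' [c' [g' [Gg' ->]]]].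
  exists (m + m')%N, (fun i => match split i with inl j => c j | inr j => c' j end),
    (fun i => match split i with inl j => g j | inr j => g' j end).
  split=> [i|]; first by case: (split i).
  rewrite big_split_ord /=; congr (_ + _); apply: eq_bigr => i _.
    by rewrite (unsplitK (inl i)).
  by rewrite (unsplitK (inr i)).
- move=> h _ [m [c [g [Gg ->]]]]; exists m, (fun i => h * c i), g; split=> //.
  by rewrite mulr_sumr; apply: eq_bigr => i _; rewrite mulrA.
Qed.

Lemma add_genP J f g : is_ideal J ->
  add_gen J f g <-> exists j h, J j /\ g = j + h * f.
Proof.
move=> iJ; have [J0 JD JM] := iJ; split=> [|[j [h [Jj ->]]]].
  apply: (@ideal_genS _ [set g | exists j h, J j /\ g = j + h * f]).
    split.
    - by exists 0, 0; rewrite mul0r addr0.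
    - move=> _ _ [j [h [Jj ->]]] [j' [h' [Jj' ->]]]; exists (j + j'), (h + h').
      by split; [exact: JD | ring].
    - move=> k _ [j [h [Jj ->]]]; exists (k * j), (k * h).
      by split; [exact: JM | ring].
  move=> x [Jx|->]; first by exists x, 0; rewrite mul0r addr0.
  by exists 0, 1; rewrite mul1r add0r.
have [_ GD GM] := ideal_gen_ideal (J `|` [set f]).
by apply: GD; [|apply: GM]; apply: sub_ideal_gen; [left|right].
Qed.

Lemma add_gen_ideal J f : is_ideal (add_gen J f).
Proof. exact: ideal_gen_ideal. Qed.

Lemma colon_ideal J f :
  is_ideal J -> is_ideal (colon J f).
Proof.
move=> [J0 JD JM]; split=> [|g h|k g]; rewrite /colon /=.
- by rewrite mul0r.
- by rewrite mulrDl; exact: JD.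
- by rewrite -mulrA; exact: JM.
Qed.

Lemma sub_colon J f :
  is_ideal J -> J `<=` colon J f.
Proof. by move=> [_ _ JM] g Jg; rewrite /colon /= mulrC; exact: JM. Qed.

End Ideals.

(** * Graded ideals and chains of primes *)

Section GradedIdeals.
Variables (K : fieldType) (s : nat).
Local Notation S := {mpoly K[s]}.
Implicit Types (J : set S) (f g h : S).

Lemma pihomogM_homog e d f h : f \is e.-homog ->
  pihomog mdeg d (h * f) = if (e <= d)%N then pihomog mdeg (d - e) h * f else 0.
Proof.
move=> fe; have hM i : pihomog mdeg i h * f \is (i + e).-homog.
  by apply: dhomogM => //; exact: pihomogP.
rewrite {1}(pihomog_partitionE (leqnn (msize h))) mulr_suml raddf_sum /=.
have [ed|ed] := leqP e d; last first.
  by apply: big1 => i _; rewrite (pihomog_ne0 _ (hM i)) //; lia.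
case: (ltnP (d - e) (msize h)) => hd; last first.
  rewrite big1 => [|i _].
    suff -> : pihomog mdeg (d - e) h = 0 by rewrite mul0r.
    apply/mpolyP => m; rewrite mcoeff_pihomog mcoeff0; case: eqP => // md.
    by apply/eqP; rewrite mcoeff_eq0; apply: msize_mdeg_ge; rewrite md.
  by rewrite (pihomog_ne0 _ (hM i)) //; have := ltn_ord i; lia.
rewrite (bigD1 (Ordinal hd)) //= big1 ?addr0 => [|i nid]; last first.
  rewrite (pihomog_ne0 _ (hM i)) //; apply: contra nid => /eqP ied.
  by apply/eqP/val_inj; rewrite /= -ied addnK.
by rewrite pihomog_dE // -[X in X.-homog](subnK ed).
Qed.

Lemma colon_graded e J f : graded J -> f \is e.-homog -> graded (colon J f).
Proof.
move=> gJ fe h Jhf d; have := gJ _ Jhf (d + e)%N.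
by rewrite (pihomogM_homog _ _ fe) leq_addl addnK.
Qed.

Lemma add_gen_graded e J f : is_ideal J -> graded J -> f \is e.-homog ->
  graded (add_gen J f).
Proof.
move=> iJ gJ fe g /(add_genP _ _ iJ)[j [h [Jj ->]]] d; apply/add_genP => //.
exists (pihomog mdeg d j), (if (e <= d)%N then pihomog mdeg (d - e) h else 0).
split; first exact: gJ.
by rewrite raddfD /= (pihomogM_homog _ _ fe); case: ifP; rewrite ?mul0r.
Qed.

Section Counting.
Variable le : rel 'X_{1..s}.
Hypothesis hle : monomial_order le.

(** Exactness of 0 -> S/(J : f) -> S/J -> S/(J, f) -> 0, of which only the
    resulting inequality between Hilbert functions is kept. *)
Lemma affine_count_subadd e J f n : is_ideal J -> graded J -> f \is e.-homog ->
  (affine_count (lead_mons le J) (n + e) <=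
     affine_count (lead_mons le (add_gen J f)) (n + e)
     + affine_count (lead_mons le (colon J f)) n)%N.
Proof.
move=> iJ gJ fe; have sJ := ideal_subspace iJ; have [J0 JD JM] := iJ.
have gA := add_gen_graded iJ gJ fe; have gC := colon_graded gJ fe.
have sA := ideal_subspace (add_gen_ideal J f).
have sC := ideal_subspace (colon_ideal f iJ).
rewrite /affine_count -!standard_mons //.
set L := standard _ J _; set L1 := standard _ (add_gen J f) _.
set L2 := standard _ (colon J f) _.
have uL : uniq L by rewrite filter_uniq ?mons_uniq.
have uL1 : uniq L1 by rewrite filter_uniq ?mons_uniq.
have uL2 : uniq L2 by rewrite filter_uniq ?mons_uniq.
have LT : {subset L <= mons s (n + e)} by move=> a; rewrite mem_filter => /andP[].
have L1T : {subset L1 <= mons s (n + e)} by move=> a; rewrite mem_filter => /andP[].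
pose c (i : 'I_(size L1) + 'I_(size L2)) : S :=
  match i with inl i => 'X_[nth 0%MM L1 i] | inr i => 'X_[nth 0%MM L2 i] * f end.
rewrite -[size L]card_ord -[size L1]card_ord -[size L2]card_ord -card_sum.
apply: (@indep_le_span _ _ J _ _ (fun i : 'I_(size L) => 'X_[nth 0%MM L i]) c) => //.
  move=> a Ja i.
  have /mpolyP/(_ (nth 0%MM L i)) := standard_free hle (@msupp_sum_monomials _ _ L a uL) Ja.
  by rewrite mcoeff0 (proj1 (mcoeff_sum_monomials a _ uL) i).
move=> i; set g := 'X_[_].
have gT : {subset msupp g <= mons s (n + e)}.
  by move=> a; rewrite msuppX inE => /eqP ->; apply/LT/mem_nth.
have [h [hL1 /(add_genP _ _ iJ)[j [q [Jj ghE]]]]] := standard_span hle sA gT.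
(* Only the part of q of degree less than n contributes in degrees < n + e. *)
pose q' := \sum_(k < n) pihomog mdeg k q.
have ghE' : J (g - h - q' * f).
  have ghT : (msize (g - h)%R <= n + e)%N.
    rewrite msizeE; apply/bigmax_leqP_seq => a /msuppB_le + _.
    by rewrite mem_cat => /orP[/gT|/hL1/L1T]; rewrite mem_mons.
  rewrite (pihomog_partitionE ghT) ghE.
  under eq_bigr do rewrite raddfD /=.
  rewrite big_split /=.
  suff -> : \sum_(k < n + e) pihomog mdeg k (q * f) = q' * f.
    rewrite addrK; apply: (subspace_sum _ sJ) => k _; exact: gJ.
  rewrite addnC big_split_ord /= big1 ?add0r => [|k _]; last first.
    by rewrite (pihomogM_homog _ _ fe) leqNgt ltn_ord.
  rewrite mulr_suml; apply: eq_bigr => k _.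
  by rewrite (pihomogM_homog _ _ fe) leq_addr addKn.
have q'T : {subset msupp q' <= mons s n}.
  move=> a /msupp_sum_le /flattenP[/= _ /mapP[k _ ->]].
  by rewrite mem_pihomog mem_mons => /andP[/eqP -> _].
have [q2 [q2L Jq2]] := standard_span hle sC q'T.
exists (fun i : 'I_(size L1) + 'I_(size L2) => match i with inl i => h@_(nth 0%MM L1 i)
                          | inr i => q2@_(nth 0%MM L2 i) end).
rewrite big_sumType /= -mpoly_sum_monomials //.
have -> : \sum_(i < size L2) q2@_(nth 0%MM L2 i) *: ('X_[nth 0%MM L2 i] * f) = q2 * f.
  rewrite [in RHS](mpoly_sum_monomials uL2 q2L) mulr_suml.
  by apply: eq_bigr => k _; rewrite scalerAl.
have -> : g - (h + q2 * f) = (g - h - q' * f) + (q' - q2) * f by ring.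
exact: JD.
Qed.

End Counting.

(** If f lies in p_1 but not in p_0, the powers of f times a family independent
    modulo p_1 are independent modulo p_0: reducing a relation modulo p_1 kills
    its constant term in f, and then f can be cancelled modulo the prime p_0. *)
Lemma chain_indep m (p : 'I_m.+1 -> set S) : prime_chain p ->
  exists2 N, (0 < N)%N & forall n, (0 < n)%N -> exists (I : finType) (b : I -> S),
    [/\ #|I| = (n ^ m)%N, indep_mod (p ord0) b & forall i, (msize (b i) <= N * n)%N].
Proof.
elim: m p => [|m IH] p [pp plt].
  exists 1%N => // n n0; exists unit, (fun=> 1); split.
  - by rewrite card_unit.
  - move=> c; rewrite (bigD1 tt) //= big1 => [|[]//]; rewrite addr0 => Pc [].
    have [[P0 PD PM] P1 _] := pp ord0.
    apply/eqP/negP => c0; apply: P1; have := PM (c tt)^-1%:MP _ Pc.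
    by rewrite mul_mpolyC scalerA mulVf ?scale1r //; exact/negP.
  - by move=> _; rewrite msize1 mul1n.
pose q (i : 'I_m.+1) := p (lift ord0 i).
have cq : prime_chain q.
  split=> [i|i j ij]; first exact: pp.
  by apply: plt; rewrite /= /bump /= !add1n ltnS.
have [N N0 IHN] := IH q cq.
have [p01 /existsNP[f /not_implyP[qf pf]]] : p ord0 `<` q ord0 by exact: plt.
exists (N + msize f)%N => [|n n0]; first by rewrite addn_gt0 N0.
have [I [b [cI indb sb]]] := IHN n n0.
exists (I * 'I_n)%type, (fun ik : I * 'I_n => f ^+ ik.2 * b ik.1); split.
- by rewrite card_prod cI card_ord expnS mulnC.
- have [[P0 PD PM] P1 Pp] := pp ord0; have [[Q0 QD QM] Q1 Qp] := pp (lift ord0 ord0).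
  have ind k (c : I -> nat -> K) :
      p ord0 (\sum_(j < k) f ^+ j * (\sum_i c i j *: b i)) ->
      forall j i, (j < k)%N -> c i j = 0.
    elim: k c => [//|k IHk] c; rewrite big_ord_recl expr0 mul1r.
    have -> : \sum_(j < k) f ^+ lift ord0 j * (\sum_i c i (lift ord0 j) *: b i)
            = f * \sum_(j < k) f ^+ j * (\sum_i c i j.+1 *: b i).
      by rewrite mulr_sumr; apply: eq_bigr => j _; rewrite mulrA -exprS.
    set h := \sum_(j < k) _; move=> Ph.
    have c0 : forall i, c i 0%N = 0.
      apply: indb; have := QD _ _ (p01 _ Ph) (QM (- h) _ qf).
      by rewrite mulNr [h * f]mulrC addrK.
    have Ph' : p ord0 h.
      move: Ph; rewrite big1 ?add0r => [|i _]; last by rewrite c0 scale0r.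
      by case/Pp.
    by move=> [|j] i jk; [exact: c0 | exact: (IHk (fun i j => c i j.+1))].
  move=> c Pc [i k].
  pose c' i j := if insub j is Some k then c (i, k) else 0.
  have c'E (k0 : 'I_n) i0 : c' i0 k0 = c (i0, k0) by rewrite /c' valK.
  rewrite -c'E; apply: (ind n c') => //; move: Pc.
  have -> : \sum_ik c ik *: (f ^+ ik.2 * b ik.1)
          = \sum_i \sum_(k < n) c (i, k) *: (f ^+ k * b i).
    by rewrite pair_bigA; apply: eq_bigr => -[].
  rewrite exchange_big /=; congr (p ord0 _); apply: eq_bigr => j _.
  by rewrite mulr_sumr; apply: eq_bigr => i0 _; rewrite c'E scalerAr.
- move=> [i k] /=; rewrite mulnDl addnC.
  have msM (g h : S) : (msize (g * h) <= msize g + msize h)%N.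
    have [->|g0] := eqVneq g 0; first by rewrite mul0r msize0.
    have [->|h0] := eqVneq h 0; first by rewrite mulr0 msize0.
    by rewrite msizeM // leq_pred.
  have le1 : (msize (f ^+ k) <= (msize f * k).+1)%N.
    elim: (k : nat) => [|l IHl]; first by rewrite expr0 msize1.
    rewrite exprS; by apply: leq_trans (msM _ _) _; rewrite mulnS -addnS leq_add2l.
  apply: leq_trans (msM _ _) (leq_add _ (sb i)).
  have f0 : msize f != 0%N.
    rewrite msize_poly_eq0; apply/eqP => f0; apply: pf; rewrite f0.
    by case: (pp ord0) => -[].
  apply: leq_trans le1 _; apply: leq_trans (_ : _ <= msize f * k.+1)%N _.
    by rewrite mulnS; lia.
  by rewrite leq_mul2l ltn_ord orbT.
Qed.

End GradedIdeals.

(** * Growth of monomial counts *)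

Section Growth.
Variable s : nat.
Local Notation mon := 'X_{1..s}.
Implicit Type M : set mon.

Definition avoids_vars M (B : {set 'I_s}) : Prop :=
  forall a, M a -> exists2 v, v \notin B & a v != 0%N.

(** When M consists of the leading monomials of an ideal J, the j variables of B
    are algebraically independent modulo J, and dim S/J >= j. *)
Definition free_vars M j : Prop := exists2 B : {set 'I_s}, #|B| = j & avoids_vars M B.

Lemma mnm_le_mdeg (a : mon) v : (a v <= mdeg a)%N.
Proof. by rewrite mdegE (bigD1 v) //= leq_addr. Qed.

Lemma affine_count_sub M M' n : M `<=` M' -> (affine_count M' n <= affine_count M n)%N.
Proof.
move=> MM'; apply: uniq_leq_size; first by rewrite filter_uniq ?mons_uniq.
move=> a; rewrite !mem_filter => /andP[M'a ->]; rewrite andbT.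
by apply: contra M'a => /asboolP/MM' /asboolP.
Qed.

Lemma affine_count_le M m n : (m <= n)%N -> (affine_count M m <= affine_count M n)%N.
Proof.
move=> mn; apply: uniq_leq_size; first by rewrite filter_uniq ?mons_uniq.
by move=> a; rewrite !mem_filter !mem_mons => /andP[-> /leq_trans ->].
Qed.

Lemma free_vars_count M j n : free_vars M j -> (0 < n)%N ->
  (n ^ j <= affine_count M (n * s.+1))%N.
Proof.
case=> B cB avB; case: n => // n _.
pose phi (g : {ffun 'I_s -> 'I_n.+1}) : mon := [multinom (g i : nat) | i < s].
have phi_inj : injective phi.
  move=> g h /mnmP gh; apply/ffunP => i; apply: val_inj.
  by have := gh i; rewrite !mnmE.
pose P := pffun_on (ord0 : 'I_n.+1) (mem B) predT.
have <- : size [seq phi g | g <- enum P] = (n.+1 ^ j)%N.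
  by rewrite size_map -cardE card_pffun_on card_ord cB.
apply: uniq_leq_size; first by rewrite map_inj_uniq ?enum_uniq.
move=> _ /mapP[g + ->]; rewrite mem_enum => /pffun_onP[gB _].
rewrite mem_filter mem_mons; apply/andP; split.
  apply/asboolP => /avB[v vB]; rewrite mnmE => gv.
  by case/negP: vB; apply: (subsetP gB); apply: contra gv => /eqP ->.
rewrite mdegE; apply: (@leq_ltn_trans (\sum_(i < s) n)%N).
  by apply: leq_sum => i _; rewrite mnmE -ltnS.
by rewrite sum_nat_const card_ord mulSn mulnS mulnC; lia.
Qed.

(** Every set B of j variables contains the support of some c_B in M; if N
    bounds all exponents of the c_B, a monomial outside M has fewer than j
    exponents that are at least N, and only these are bounded by n alone. *)
Lemma not_free_vars_count M j : up_closed M -> ~ free_vars M j ->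
  exists C, forall n, (affine_count M n * n <= C * n ^ j)%N.
Proof.
move=> uM nfree.
have exc (B : {set 'I_s}) : exists c : mon,
    #|B| = j -> M c /\ forall v, v \notin B -> c v = 0%N.
  have [cB|nB] := eqVneq #|B| j; last by exists 0%MM; move=> cB; rewrite cB eqxx in nB.
  have [[c cP]|nc] := pselect (exists c, M c /\ forall v, v \notin B -> c v = 0%N).
    by exists c; move=> _.
  case: nfree; exists B => // a Ma; apply: contrapT => na; case: nc; exists a.
  split=> // v vB; apply/eqP/negPn/negP => av; apply: na; by exists v.
have [c cP] := choice exc.
have sub (B' B : {set 'I_s}) (a : mon) N : #|B'| = j -> B' \subset B ->
    (forall v, v \in B -> (N <= a v)%N) -> (mdeg (c B') <= N)%N -> M a.
  move=> cB' BB aN cN; have [Mc c0] := cP _ cB'.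
  have ca : (c B' <= a)%MM.
    apply/mnm_lepP => v; case: (boolP (v \in B')) => vB; last by rewrite c0.
    apply: leq_trans (aN v (subsetP BB _ vB)).
    exact: leq_trans (mnm_le_mdeg _ v) cN.
  by rewrite -(submK ca) addmC; exact: uM.
case: j nfree exc cP sub => [|j] nfree exc cP sub.
  exists 0%N => n; rewrite mul0n leqn0 muln_eq0; apply/orP; left.
  rewrite size_eq0 -[_ == _]negbK -has_filter; apply/hasPn => a _.
  rewrite negbK; apply/asboolP.
  apply: (sub finset.set0 finset.set0 a (mdeg (c set0))) => //.
    exact: cards0.
  by move=> v; rewrite inE.
pose N := (\sum_B mdeg (c B))%N.
have cN B : (mdeg (c B) <= N)%N by rewrite /N (bigD1 B) //= leq_addr.
pose big (a : mon) : {set 'I_s} := finset (fun v => N < a v)%N.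
have big_lt a : ~ M a -> (#|big a| <= j)%N.
  move=> nMa; rewrite leqNgt; apply/negP => ja; apply: nMa.
  pose t := take j.+1 (enum (big a)).
  have st : #|[set v in t]| = j.+1.
    rewrite cardsE; have /card_uniqP -> : uniq t by rewrite take_uniq ?enum_uniq.
    by rewrite size_take -cardE; case: ltnP => // h; apply/eqP; rewrite eqn_leq h ja.
  apply: (sub [set v in t] (big a) a N st) => //.
    by apply/subsetP => v; rewrite inE => /mem_take; rewrite mem_enum.
  by move=> v; rewrite inE => /ltnW.
exists (#|{: {set 'I_s}}| * #|{: {ffun 'I_s -> 'I_N.+1}}|)%N.
case=> [|n]; first by rewrite muln0.
rewrite expnSr mulnA leq_mul2r /=.
pose T := ({set 'I_s} * {ffun 'I_s -> 'I_N.+1} * {ffun 'I_j -> 'I_n.+1})%type.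
have <- : #|{: T}| = (#|{: {set 'I_s}}| * #|{: {ffun 'I_s -> 'I_N.+1}}| * n.+1 ^ j)%N.
  by rewrite !card_prod [X in (_ * X)%N]card_ffun !card_ord.
(* A monomial is recovered from its set of big exponents, its exponents cut off
   at N, and the list of its big exponents. *)
pose phi (a : mon) : T :=
  (big a, [ffun v => inord (minn (a v) N)],
   [ffun k : 'I_j => inord (nth 0%N [seq a v | v <- enum (big a)] k)]).
rewrite /affine_count; set L := [seq a <- _ | _].
have uL : uniq L by rewrite filter_uniq ?mons_uniq.
suff phi_inj : {in L &, injective phi}.
  rewrite -(size_map phi) -(card_uniqP _) ?max_card // map_inj_in_uniq //.
move=> a b; rewrite !mem_filter !mem_mons => /andP[/asboolP nMa an] /andP[_ bn].
case=> eB /ffunP eS /ffunP eG; apply/mnmP => v.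
case: (boolP (v \in big a)) => vB; last first.
  have va : (a v <= N)%N by move: vB; rewrite inE -leqNgt.
  have vb : (b v <= N)%N by move: vB; rewrite eB inE -leqNgt.
  have := congr1 val (eS v); rewrite !ffunE /= !inordK ?ltnS ?geq_minr //.
  by rewrite !(minn_idPl _).
have kj : (index v (enum (big a)) < j)%N.
  by apply: leq_trans (big_lt a nMa); rewrite cardE index_mem mem_enum.
have := congr1 val (eG (Ordinal kj)); rewrite !ffunE /= -eB.
have vE : v \in enum (big a) by rewrite mem_enum.
rewrite !(nth_map v) ?index_mem // nth_index // !inordK //.
  exact: leq_ltn_trans (mnm_le_mdeg _ _) bn.
exact: leq_ltn_trans (mnm_le_mdeg _ _) an.
Qed.

(** A grows at least like n ^ i and at most like n ^ (j - 1). *)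
Lemma growth_lt (A : nat -> nat) i j c C :
  (forall n, (0 < n)%N -> (n ^ i <= A (n * c.+1))%N) ->
  (forall n, (A n * n <= C * n ^ j)%N) -> (i < j)%N.
Proof.
move=> lo up; rewrite ltnNge; apply/negP => ji.
pose n := (C * c.+1 ^ j).+1.
have := up (n * c.+1)%N; rewrite leqNgt => /negP; apply.
apply: (@leq_trans (n ^ i * (n * c.+1))); last by rewrite leq_mul2r lo ?orbT.
rewrite expnMn mulnCA mulnA.
apply: (@leq_trans (n ^ j * (n * c.+1)))%N; last first.
  by rewrite leq_mul2r leq_pexp2l ?orbT.
rewrite -mulnA ltn_pmul2l ?expn_gt0 //.
by apply: leq_trans (leq_pmulr n (ltn0Sn c)).
Qed.

End Growth.

(** * Krull dimension of a graded ideal *)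

Section Primes.
Variables (K : fieldType) (s : nat).
Local Notation S := {mpoly K[s]}.
Implicit Types (J p : set S) (f g h : S).

Lemma pihomog_msize d h : (msize h <= d)%N -> pihomog mdeg d h = 0.
Proof.
move=> hd; apply/mpolyP => m; rewrite mcoeff_pihomog mcoeff0; case: (mdeg m =P d) => // md.
by apply/eqP; rewrite mcoeff_eq0; apply: msize_mdeg_ge; rewrite md.
Qed.

Lemma msize_sub_top d f : (msize f <= d.+1)%N -> (msize (f - pihomog mdeg d f)%R <= d)%N.
Proof.
move=> fd; rewrite msizeE; apply/bigmax_leqP_seq => a + _.
rewrite mcoeff_msupp mcoeffB mcoeff_pihomog.
case: (mdeg a =P d) => [_|ad]; first by rewrite subrr eqxx.
rewrite subr0 -mcoeff_msupp => /msize_mdeg_lt af.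
by have := leq_trans af fd; rewrite ltnS leq_eqVlt => /orP[/eqP|].
Qed.

(** By induction on the degrees: the top forms F of f and G of g multiply to the
    top form of f * g, so p contains F * G, hence F or G, and this one can be
    subtracted from f or g. *)
Lemma graded_prime p : is_ideal p -> graded p -> ~ p 1 ->
    (forall d e f g, f \is d.-homog -> g \is e.-homog -> p (f * g) -> p f \/ p g) ->
  is_prime p.
Proof.
move=> ip gp p1 ph; split=> // f g.
have [n] : exists n, (msize f + msize g <= n)%N by exists (msize f + msize g)%N.
have [p0 pD pM] := ip; have sp := ideal_subspace ip.
elim: n f g => [|n IH] f g fgn pfg.
  left; suff /eqP -> : f == 0 by [].
  by rewrite -msize_poly_eq0; move: fgn; lia.
have [->|f0] := eqVneq f 0; first by left.
have [->|g0] := eqVneq g 0; first by right.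
set a := (msize f).-1; set b := (msize g).-1.
have ea : msize f = a.+1 by rewrite /a prednK // lt0n msize_poly_eq0.
have eb : msize g = b.+1 by rewrite /b prednK // lt0n msize_poly_eq0.
set F := pihomog mdeg a f; set G := pihomog mdeg b g.
have sF : (msize (f - F)%R <= a)%N by apply: msize_sub_top; rewrite ea.
have sG : (msize (g - G)%R <= b)%N by apply: msize_sub_top; rewrite eb.
have pFG : p (F * G).
  have -> : F * G = pihomog mdeg (b + a) (f * g).
    rewrite [LHS]mulrC; have -> : f * g = g * F + (f - F) * g by ring.
    rewrite raddfD /= (pihomogM_homog _ _ (pihomogP _ a f)) leq_addl addnK.
    rewrite [X in _ = _ + X]pihomog_msize ?addr0 //.
    have [e0|fF0] := eqVneq (f - F) 0; first by rewrite e0 mul0r msize0.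
    by rewrite msizeM // eb addnS /= addnC leq_add2l.
  exact: gp.
case: (ph _ _ _ _ (pihomogP _ a f) (pihomogP _ b g) pFG) => pF.
- have [||pf|pg] := IH (f - F) g; [by lia| |left|by right].
    by rewrite mulrBl; apply: (subspaceB sp pfg); rewrite mulrC; exact: pM.
  by rewrite -(subrK F f); exact: pD.
- have [||pf|pg] := IH f (g - G); [by lia| |by left|right].
    by rewrite mulrBr; apply: (subspaceB sp pfg); exact: pM.
  by rewrite -(subrK G g); exact: pD.
Qed.

Section Dimension.
Variable le : rel 'X_{1..s}.
Hypothesis hle : monomial_order le.
Local Notation Lm := (lead_mons le).
Local Notation free J j := (free_vars (Lm J) j).

Lemma lead_mons_sub J p : J `<=` p -> Lm J `<=` Lm p.
Proof. by move=> Jp a [f Jf fa]; exists f => //; exact: Jp. Qed.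

Lemma lead_monsX J a : J 'X_[a] -> Lm J a.
Proof.
move=> Ja; exists 'X_[a] => //; split; first by rewrite msuppX inE.
move=> b; rewrite msuppX inE => /eqP ->.
by case: hle => _ _ tot _ _; case/orP: (tot a a).
Qed.

Lemma chain_ub (T : Type) (I : finType) (F : set (set T)) (X0 : set T) (X : I -> set T) :
  total_on F (fun A B => A `<=` B) -> F X0 -> (forall i, F (X i)) ->
  exists Y, [/\ F Y, X0 `<=` Y & forall i, X i `<=` Y].
Proof.
move=> totF FX0 FX.
have [Y [FY X0Y XY]] : exists Y, [/\ F Y, X0 `<=` Y & forall i, i \in enum I -> X i `<=` Y].
  elim: (enum I) => [|i r [Y [FY X0Y XY]]]; first by exists X0; split.
  case: (totF _ _ FY (FX i)) => YX.
    exists (X i); split=> //; first exact: classical_sets.subset_trans YX.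
    by move=> j; rewrite inE => /orP[/eqP -> //|/XY] /classical_sets.subset_trans; apply.
  by exists Y; split=> // j; rewrite inE => /orP[/eqP -> //|/XY].
by exists Y; split=> // i; apply: XY; rewrite mem_enum.
Qed.

(** Zorn's lemma applies because there are only finitely many sets B of j
    variables: if every B failed for the union of a chain, through a leading
    monomial of some member, then a single member would contain all these. *)
Lemma maximal_free J j : is_ideal J -> graded J -> free J j ->
  exists p, [/\ J `<=` p, is_ideal p, graded p, free p j
    & forall q, is_ideal q -> graded q -> p `<` q -> ~ free q j].
Proof.
move=> iJ gJ fJ.
pose P X := [/\ J `<=` X, is_ideal X, graded X & free X j].
(* The empty set is let in as the union of the empty chain. *)
have [|A [PA maxA]] := @Zorn_bigcup _ (fun X => X = classical_sets.set0 \/ P X).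
  move=> F FP totF.
  have [[X0 [FX0 nX0]]|allE] :=
    pselect (exists X, F X /\ X <> classical_sets.set0); last first.
    left; rewrite -classical_sets.subset0 => x [X FX Xx]; apply: allE.
    exists X; split=> // X0.
    by rewrite X0 in Xx.
  right; have real X x : F X -> X x -> P X.
    by move=> FX Xx; case: (FP X FX) => // X0'; rewrite X0' in Xx.
  have [JX0 iX0 gX0 fX0] : P X0 by case: (FP _ FX0).
  have [X00 X0D X0M] := iX0.
  split.
  - by move=> x /JX0 Xx; exists X0.
  - split; first by exists X0.
      move=> f g [X FX Xf] [Y FY Yg].
      have [_ [_ XD _] _ _] := real _ _ FX Xf; have [_ [_ YD _] _ _] := real _ _ FY Yg.
      case: (totF _ _ FX FY) => XY.
        by exists Y => //; apply: YD => //; exact: XY.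
      by exists X => //; apply: XD => //; exact: XY.
    move=> h f [X FX Xf]; exists X => //.
    by have [_ [_ _ XM] _ _] := real _ _ FX Xf; exact: XM.
  - move=> f [X FX Xf] d; exists X => //.
    by have [_ _ gX _] := real _ _ FX Xf; exact: gX.
  - apply: contrapT => nU.
    have ex (B : {set 'I_s}) : exists X, F X /\ (#|B| = j ->
        exists2 a, Lm X a & forall v, v \notin B -> a v = 0%N).
      have [cB|nB] := eqVneq #|B| j; last first.
        by exists X0; split=> // cB; rewrite cB eqxx in nB.
      apply: contrapT => nX; apply: nU; exists B => // a [f [X FX Xf] fa].
      apply: contrapT => nv; apply: nX; exists X; split=> // _; exists a; first by exists f.
      by move=> v vB; apply/eqP/negPn/negP => av; apply: nv; exists v.
    have [X XP] := choice ex.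
    have [Y [FY X0Y XY]] := @chain_ub _ _ F X0 X totF FX0 (fun B => proj1 (XP B)).
    have [_ _ _ [B cB avB]] : P Y by apply: (real Y 0) => //; exact: X0Y.
    have [a Xa aB] := proj2 (XP B) cB.
    have [v vB] := avB a (lead_mons_sub (XY B) Xa).
    by rewrite aB.
have PJ : P J by split.
have [J0 _ _] := iJ.
have [JA iA gA fA] : P A.
  case: PA => // A0; exfalso; apply: (maxA J); last by right.
  by rewrite A0; split=> // /(_ 0 J0).
exists A; split=> // q iq gq Aq fq; apply: (maxA q Aq); right; split=> //.
by apply: classical_sets.subset_trans JA _; case: Aq.
Qed.

Lemma free_growth J j : is_ideal J -> ~ free J j ->
  exists C, forall n, (affine_count (Lm J) n * n <= C * n ^ j)%N.
Proof. by move=> iJ; apply: not_free_vars_count; exact: lead_mons_up. Qed.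

Lemma free_not1 J j : free J j -> ~ J 1.
Proof.
case=> B _ avB J1; have [] := avB 0%MM; last by move=> v _; rewrite mnm0E.
by apply: lead_monsX; rewrite mpolyX0.
Qed.

(** If f and g were homogeneous outside p with f g in p, both (p, f) and
    (p : f) would be strictly larger, hence of smaller dimension; but by
    subadditivity their Hilbert functions dominate that of p. *)
Lemma maximal_free_prime p j : is_ideal p -> graded p -> free p j ->
  (forall q, is_ideal q -> graded q -> p `<` q -> ~ free q j) -> is_prime p.
Proof.
move=> ip gp fp pmax; apply: graded_prime => //; first exact: free_not1 fp.
move=> d e f g fd ge pfg; apply: contrapT => /not_orP[npf npg].
have [||C1 HC1] := @free_growth (add_gen p f) j; first exact: add_gen_ideal.
  apply: pmax; [exact: add_gen_ideal|exact: add_gen_graded fd|split].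
    by move=> x px; apply: sub_ideal_gen; left.
  by move/(_ f) => sub; apply: npf; apply: sub; apply: sub_ideal_gen; right.
have [||C2 HC2] := @free_growth (colon p f) j; first exact: colon_ideal.
  apply: pmax; [exact: colon_ideal|exact: colon_graded fd|split].
    exact: sub_colon.
  by move/(_ g) => sub; apply: npg; apply: sub; rewrite /colon /= mulrC.
suff : (j < j)%N by rewrite ltnn.
apply: (@growth_lt (affine_count (Lm p)) j j s (C1 * d.+1 ^ j + C2)).
  by move=> n n0; exact: free_vars_count.
case=> [|n]; first by rewrite muln0.
apply: (@leq_trans ((affine_count (Lm (add_gen p f)) (n.+1 + d)
          + affine_count (Lm (colon p f)) n.+1) * n.+1)).
  rewrite leq_mul2r; apply/orP; right.
  apply: leq_trans (affine_count_subadd hle n.+1 ip gp fd).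
  by apply: affine_count_le; exact: leq_addr.
rewrite !mulnDl; apply: leq_add; last exact: HC2.
apply: (@leq_trans (C1 * (n.+1 + d) ^ j)).
  apply: leq_trans (HC1 _); rewrite leq_mul2l; apply/orP; right; exact: leq_addr.
rewrite -mulnA -expnMn leq_mul2l; apply/orP; right.
by case: j {fp pmax HC1 HC2} => // j; rewrite leq_exp2r //; nia.
Qed.

(** A maximal p as above is the first prime.  It omits some variable t_v, and
    its cumulative Hilbert function at n is at most n times that of (p, t_v), so
    that (p, t_v) has dimension at least j - 1 and starts the rest of the chain. *)
Lemma free_chain J j : is_ideal J -> graded J -> free J j ->
  exists2 q : 'I_j.+1 -> set S, prime_chain q & J `<=` q ord0.
Proof.
elim: j J => [|j IH] J iJ gJ fJ.
  have [p [Jp ip gp fp pmax]] := maximal_free iJ gJ fJ.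
  exists (fun=> p) => //; split=> [_|i k]; first exact: maximal_free_prime fp pmax.
  by rewrite !ord1.
have [p [Jp ip gp fp pmax]] := maximal_free iJ gJ fJ.
have pp := maximal_free_prime ip gp fp pmax.
have [B cB avB] := fp.
have [v vB] : exists v, v \in B by apply/set0Pn; rewrite -card_gt0 cB.
have Xp : ~ p 'X_v.
  move=> /lead_monsX/avB[w wB]; rewrite mnm1E; case: (v =P w) => // vw _.
  by rewrite -vw vB in wB.
have hX : ('X_v : S) \is 1.-homog by rewrite dhomogX /= mdeg1.
have iX := add_gen_ideal p 'X_v; have gX := add_gen_graded ip gp hX.
have fX : free (add_gen p 'X_v) j.
  apply: contrapT => nf; have [C HC] := free_growth iX nf.
  suff : (j.+1 < j.+1)%N by rewrite ltnn.
  apply: (@growth_lt (affine_count (Lm p)) j.+1 j.+1 s C).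
    by move=> n n0; exact: free_vars_count.
  move=> n; rewrite expnSr mulnA leq_mul2r; apply/orP; right.
  apply: leq_trans (HC n); rewrite mulnC.
  elim: n => [|n IHn].
    rewrite leqn0 size_eq0 -[_ == _]negbK -has_filter.
    by apply/hasPn => a; rewrite mem_mons.
  rewrite -addn1; apply: leq_trans (affine_count_subadd hle n ip gp hX) _.
  rewrite [X in (_ <= X)%N]mulnDl mul1n addnC leq_add2r.
  apply: (@leq_trans (n * affine_count (Lm (add_gen p 'X_v)) n)).
    apply: leq_trans IHn; apply: affine_count_sub; apply: lead_mons_sub.
    exact: sub_colon.
  rewrite leq_mul2l; apply/orP; right; apply: affine_count_le; exact: leq_addr.
have [q [qp qlt] Xq] := IH _ iX gX fX.
have pq i : p `<` q i.
  have Xqi : add_gen p 'X_v `<=` q i.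
    apply: classical_sets.subset_trans Xq _; have [->//|i0] := eqVneq i ord0.
    by case: (qlt ord0 i); rewrite // lt0n.
  split; first by move=> x px; apply: Xqi; apply: sub_ideal_gen; left.
  by move/(_ 'X_v) => sub; apply: Xp; apply: sub; apply: Xqi; apply: sub_ideal_gen; right.
exists (fun i => if unlift ord0 i is Some k then q k else p); last by rewrite unlift_none.
split=> [i|i k]; first by case: (unlift ord0 i) => [?|]; [exact: qp|exact: pp].
case: (unliftP ord0 i) => [i' ->|->]; case: (unliftP ord0 k) => [k' ->|->] //.
by rewrite !lift0 ltnS => /qlt.
Qed.

(** A chain of length m above J provides n ^ m elements of degree O(n) that are
    independent modulo J. *)
Lemma chain_lt J j m (q : 'I_m.+1 -> set S) : is_ideal J -> graded J ->
  ~ free J j -> prime_chain q -> J `<=` q ord0 -> (m < j)%N.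
Proof.
move=> iJ gJ nf cq Jq; have [C HC] := free_growth iJ nf.
have [[|N] // _ HN] := chain_indep cq.
apply: (@growth_lt (affine_count (Lm J)) m j N C) => // n n0.
have [I [b [<- indb sb]]] := HN n n0.
apply: (indep_le_affine hle iJ gJ (b := b)) => [c Jc|i]; first by apply: indb; exact: Jq.
by rewrite mulnC.
Qed.

Lemma supremum_max (A : set nat) k : A k -> (forall m, A m -> (m <= k)%N) ->
  supremum 0%N A = k.
Proof.
move=> Ak ubk; rewrite /supremum ifF; last by apply/negP => /eqP A0; rewrite A0 in Ak.
apply: xget_subset1; last exact: is_subset1_supremums.
by split=> [m /ubk|m /(_ k Ak)]; rewrite ?leEnat.
Qed.

Lemma dim_quotE J k : is_ideal J -> graded J -> free J k -> ~ free J k.+1 ->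
  dim_quot J = k.
Proof.
move=> iJ gJ fk nfk; apply: supremum_max => [|m [q [cq Jq]]].
  by have [q cq Jq] := free_chain iJ gJ fk; exists q.
by rewrite -ltnS; exact: chain_lt Jq.
Qed.

End Dimension.
End Primes.

(** * Heights and disjoint supports *)

Section Height.
Variables (K : fieldType) (s : nat).
Local Notation S := {mpoly K[s]}.
Implicit Types (J : set S) (A B : {set 'I_s}).

Definition kill_vars A (f : S) : S :=
  f \mPo [tuple if i \in A then 0 else 'X_i | i < s].

(** The ideal generated by the variables in A, presented as a kernel so that its
    primality comes from the target being a domain. *)
Definition vars_prime A : set S := [set f | kill_vars A f = 0].

Lemma kill_varsX A m :
  kill_vars A 'X_[m] = \prod_(i < s) (if i \in A then 0 else 'X_i) ^+ m i.
Proof. by rewrite /kill_vars comp_mpolyX; apply: eq_bigr => i _; rewrite tnth_mktuple. Qed.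

Lemma kill_vars_sub A B f : A \subset B -> kill_vars B (kill_vars A f) = kill_vars B f.
Proof.
move=> AB; have E C g : kill_vars C g = \sum_(m <- msupp g) g@_m *: kill_vars C 'X_[m].
  exact: comp_mpolyEX.
rewrite (E A f) (E B f) {1}/kill_vars raddf_sum; apply: eq_bigr => m _ /=.
rewrite comp_mpolyZ !kill_varsX; congr (_ *: _).
rewrite rmorph_prod; apply: eq_bigr => i _ /=.
rewrite rmorphXn /=; case: ifP => iA; last by rewrite comp_mpolyXU -tnth_nth tnth_mktuple.
by rewrite (subsetP AB _ iA) comp_mpoly0.
Qed.

Lemma vars_prime_prime A : is_prime (vars_prime A).
Proof.
rewrite /vars_prime /kill_vars; split=> [|/eqP|f g /eqP] /=.
- split=> [|f g f0 g0|h f f0] /=.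
  + exact: comp_mpoly0.
  + by rewrite comp_mpolyD f0 g0 addr0.
  + by rewrite rmorphM /= f0 mulr0.
- by rewrite comp_mpoly1 oner_eq0.
- by rewrite rmorphM /= mulf_eq0 => /orP[/eqP|/eqP]; [left|right].
Qed.

Lemma vars_primeX A (m : 'X_{1..s}) v : v \in A -> m v != 0%N -> vars_prime A 'X_[m].
Proof.
move=> vA mv; rewrite /vars_prime /= kill_varsX (bigD1 v) //= vA.
by rewrite expr0n (negPf mv) mul0r.
Qed.

Lemma vars_prime_lt A w : w \notin A -> vars_prime A `<` vars_prime (w |: A).
Proof.
move=> wA; split=> [f f0|/(_ 'X_w)].
  by rewrite /vars_prime /= -(kill_vars_sub _ (subsetU1 w A)) f0; exact: comp_mpoly0.
move/(_ (vars_primeX (setU11 w A) _)); rewrite mnm1E eqxx => /(_ isT).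
rewrite /vars_prime /= /kill_vars comp_mpolyXU -tnth_nth tnth_mktuple (negPf wA).
by move/eqP; rewrite -msize_poly_eq0 msizeX.
Qed.

Lemma prime_chain_rcons m (q : 'I_m.+1 -> set S) P :
  prime_chain q -> is_prime P -> q ord_max `<` P ->
  exists2 q' : 'I_m.+2 -> set S, prime_chain q' & q' ord_max = P.
Proof.
move=> [qp qlt] pP qP.
exists (fun i => if unlift ord_max i is Some k then q k else P); last first.
  by rewrite unlift_none.
have qiP i : q i `<` P.
  have [->//|im] := eqVneq i ord_max; have iq : q i `<` q ord_max.
    by apply: qlt; rewrite ltn_neqAle im /= -ltnS.
  split; first exact: classical_sets.subset_trans (proj1 iq) (proj1 qP).
  by move=> /classical_sets.subset_trans/(_ (proj1 iq)); case: qP.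
split=> [i|i k]; first by case: (unlift ord_max i) => [?|]; [exact: qp|].
case: (unliftP ord_max i) => [i' ->|->]; case: (unliftP ord_max k) => [k' ->|->] //.
- by rewrite !lift_max; exact: qlt.
- by rewrite lift_max /= ltnNge ltnW ?ltn_ord.
- by rewrite ltnn.
Qed.

Variable le : rel 'X_{1..s}.
Hypothesis hle : monomial_order le.

(** There are only s variables, so s + 1 of them are never independent. *)
Lemma chain_le_vars m (q : 'I_m.+1 -> set S) : prime_chain q -> (m <= s)%N.
Proof.
move=> cq; have [[q0 qD qM] _ _] := proj1 cq ord0.
have i0 : is_ideal ((fun f => f = 0) : set S).
  by split=> [//|f g -> ->|h f ->]; rewrite ?addr0 ?mulr0.
have g0 : graded ((fun f => f = 0) : set S) by move=> f -> d; exact: pihomog0.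
rewrite -ltnS; apply: (chain_lt hle i0 g0 _ cq); last by move=> f ->.
by case=> B cB _; have := max_card (mem B); rewrite cB card_ord ltnn.
Qed.

(** A longer chain below the prime of A could be prolonged, adding the other
    variables one at a time, to a chain of length greater than the number of
    variables. *)
Lemma vars_prime_chain A m (q : 'I_m.+1 -> set S) :
  prime_chain q -> q ord_max = vars_prime A -> (m <= #|A|)%N.
Proof.
move: {2}#|~: A| (leqnn #|~: A|) => n; elim: n A m q => [|n IH] A m q.
  rewrite leqn0 => /eqP cA cq _; have := chain_le_vars cq.
  by rewrite -{1}[s]card_ord -(cardsC A) cA addn0.
move=> cA cq qA; have [/eqP A0|] := boolP (~: A == finset.set0).
  have := chain_le_vars cq.
  by rewrite -{1}[s]card_ord -(cardsC A) A0 cards0 addn0.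
case/set0Pn => w; rewrite inE => wA.
have [|q' cq' q'A] := prime_chain_rcons cq (vars_prime_prime (w |: A)).
  by rewrite qA; exact: vars_prime_lt.
rewrite -ltnS; have := IH (w |: A) _ q' _ cq' q'A; rewrite cardsU1 wA; apply.
rewrite -ltnS; apply: leq_trans cA; apply: proper_card; rewrite properE.
rewrite setCS subsetU1 /=; apply/subsetPn; exists w; rewrite ?inE //.
by rewrite eqxx.
Qed.

Lemma supremum_le (A : set nat) k : (forall m, A m -> (m <= k)%N) ->
  (supremum 0%N A <= k)%N.
Proof.
move=> ubk; rewrite /supremum; case: ifP => // _.
case: xgetP => [x _ [_ lx]|] //; first by apply: lx => m /ubk.
Qed.

Lemma height_le_vars J A : J `<=` vars_prime A -> (height J <= #|A|)%N.
Proof.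
move=> JA; rewrite /height.
set H := (X in infimum _ X).
have HA : H (prime_height (vars_prime A)).
  by exists (vars_prime A) => //; split=> //; exact: vars_prime_prime.
apply: (@leq_trans (prime_height (vars_prime A))).
  rewrite /infimum; case: ifP => // _.
  by case: xgetP => [x _ [lx _]|] //; exact: lx.
by apply: supremum_le => m [q [cq qA]]; exact: vars_prime_chain cq qA.
Qed.

(** If two of the r generators share a variable, r - 1 variables are enough to
    meet the supports of all generators, and they generate a prime of height at
    most r - 1 above the ideal. *)
Lemma disjoint_supports r (alpha : 'I_r -> 'X_{1..s}) J :
    J = ideal_gen (range (fun i => 'X_[alpha i])) -> height J = r ->
    (forall i, (1 <= mdeg (alpha i))%N) ->
  forall i j v, alpha i v != 0%N -> alpha j v != 0%N -> i = j.
Proof.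
move=> JE htJ apos i j v iv jv; apply/eqP; apply: contraT => nij.
have exw k : exists w, alpha k w != 0%N /\ ((k == i) || (k == j) -> w = v).
  have [/orP[/eqP ->|/eqP ->]|_] := boolP ((k == i) || (k == j)); try by exists v.
  apply: contrapT => nw; have := apos k; rewrite mdegE big1 // => w _.
  by apply/eqP/negPn/negP => kw; apply: nw; exists w.
have [w wP] := choice exw.
have: (height J <= #|w @: (finset.setT :\ i)|)%N.
  apply: height_le_vars; rewrite JE; apply: ideal_genS.
    by case: (vars_prime_prime (w @: (finset.setT :\ i))).
  move=> _ [k _ <-]; apply: (@vars_primeX _ _ (w k)); last by case: (wP k).
  have [->|ki] := eqVneq k i; last by apply: imset_f; rewrite !inE ki.
  have -> : w i = w j by rewrite !(proj2 (wP _)) ?eqxx ?orbT.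
  by apply: imset_f; rewrite !inE eq_sym nij.
rewrite htJ leqNgt => /negP; case.
apply: (@leq_ltn_trans #|finset.setT :\ i|); first exact: leq_imset_card.
have e := cardsD1 i finset.setT; rewrite cardsT card_ord inE in e.
exact: eq_leq (esym e).
Qed.

End Height.

(** * Hilbert functions of polynomial growth *)

Section Limits.

(** The number of monomials of degree d in k variables. *)
Definition monom_count k d : nat := if k is k'.+1 then 'C(d + k', k') else (d == 0)%N.

Definition delay (j : nat) (u : nat -> nat) d : nat :=
  if (j <= d)%N then u (d - j)%N else 0%N.

(** The coefficients of the series with numerator the sum of the T ^ j, for j in
    c, and denominator (1 - T) ^ k. *)
Definition delayed_sum k (c : seq nat) d : nat :=
  (\sum_(j <- c) delay j (monom_count k) d)%N.

Lemma delay_delay i j u d : delay i (delay j u) d = delay (j + i) u d.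
Proof.
rewrite /delay; case: (leqP i d) => id; last by rewrite ifF //; lia.
by rewrite leq_subRL // [(i + j)%N]addnC; case: ifP => // _; congr u; lia.
Qed.

Lemma delayD j u v d : delay j (fun d => u d + v d)%N d = (delay j u d + delay j v d)%N.
Proof. by rewrite /delay; case: ifP. Qed.

Lemma eq_delay j u v d : u =1 v -> delay j u d = delay j v d.
Proof. by move=> uv; rewrite /delay uv. Qed.

Lemma monom_count_pascal k d :
  monom_count k.+1 d = (delay 1 (monom_count k.+1) d + monom_count k d)%N.
Proof.
case: d => [|d]; first by case: k => [|k] //=; rewrite !add0n !binn.
rewrite /delay subn1 /=; case: k => [|k]; first by rewrite !bin0.
by rewrite !addSn binS addnS.
Qed.

Lemma delay_monom_count k n j d :
  delay j (monom_count k.+1) d =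
  (delay (j + n) (monom_count k.+1) d + \sum_(i < n) delay (j + i) (monom_count k) d)%N.
Proof.
elim: n => [|n ->]; first by rewrite addn0 big_ord0 addn0.
rewrite big_ord_recr /= addnA addnAC; congr (_ + _)%N.
rewrite (eq_delay _ _ (monom_count_pascal k)) delayD delay_delay; congr (_ + _)%N.
by congr delay; lia.
Qed.

Lemma delayed_sum_delay k c j d :
  delay j (delayed_sum k c) d = delayed_sum k [seq (i + j)%N | i <- c] d.
Proof.
rewrite /delayed_sum big_map [LHS]/delay; case: ifP => jd.
  by apply: eq_bigr => i _; rewrite -delay_delay /delay jd.
by rewrite big1 // => i _; rewrite -delay_delay /delay jd.
Qed.

(** Multiplying the series by 1 - T ^ n trades one factor 1 - T of the
    denominator for 1 + T + ... + T ^ (n - 1) in the numerator. *)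
Lemma delayed_sum_step k c n : exists2 c', size c' = (size c * n)%N &
  forall d, delayed_sum k.+1 c d = (delay n (delayed_sum k.+1 c) d + delayed_sum k c' d)%N.
Proof.
exists [seq (j + i)%N | j <- c, i <- iota 0 n]; first by rewrite size_allpairs size_iota.
move=> d; rewrite delayed_sum_delay /delayed_sum big_map.
rewrite big_allpairs_dep -big_split; apply: eq_bigr => j _ /=.
by rewrite [LHS](delay_monom_count k n) -[X in iota _ X]subn0 -/(index_iota _ _) big_mkord.
Qed.

Definition growth_limit k (u : nat -> nat) (l : rat) : Prop :=
  (fun d : nat => (k`!)%:R * (u d)%:R / d%:R ^+ k : rat^o) @ \oo --> (l : rat^o).

Lemma growth_limit_unique k u l l' : growth_limit k u l -> growth_limit k u l' -> l = l'.
Proof. by apply: cvg_unique; exact: norm_hausdorff. Qed.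

Lemma growth_limit_le k u u' l l' : (forall d, u d <= u' d)%N ->
  growth_limit k u l -> growth_limit k u' l' -> l <= l'.
Proof.
move=> uu' ul ul'; apply: (@ler_cvg_to _ _ _ rat _ _ _ _ ul ul').
apply: nearW => d; rewrite ler_wpM2r ?invr_ge0 ?exprn_ge0 ?ler0n //.
by rewrite ler_wpM2l ?ler0n // ler_nat.
Qed.

Lemma growth_limitD k u u' l l' : growth_limit k u l -> growth_limit k u' l' ->
  growth_limit k (fun d => u d + u' d)%N (l + l').
Proof.
move=> ul ul'; rewrite /growth_limit.
rewrite (_ : (fun d => _) = (fun d : nat => (k`!)%:R * (u d)%:R / d%:R ^+ k : rat^o)
    \+ (fun d : nat => (k`!)%:R * (u' d)%:R / d%:R ^+ k : rat^o)).
  exact: cvgD.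
by apply/funext => d /=; rewrite natrD mulrDr mulrDl.
Qed.

Lemma growth_limitB k u u' l l' : (forall d, u' d <= u d)%N ->
  growth_limit k u l -> growth_limit k u' l' ->
  growth_limit k (fun d => u d - u' d)%N (l - l').
Proof.
move=> uu' ul ul'; rewrite /growth_limit.
rewrite (_ : (fun d => _) = (fun d : nat => (k`!)%:R * (u d)%:R / d%:R ^+ k : rat^o)
    \- (fun d : nat => (k`!)%:R * (u' d)%:R / d%:R ^+ k : rat^o)).
  exact: cvgB.
by apply/funext => d /=; rewrite natrB // mulrBr mulrBl.
Qed.

(** By induction on k, from (k + 1) C(n, k + 1) = n C(n - 1, k).  The index is
    shifted by j + 1 so that the delay and the denominator 0 disappear. *)
Lemma growth_limit_delay k j : growth_limit k (delay j (monom_count k.+1)) 1.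
Proof.
rewrite /growth_limit -(cvg_shiftn j.+1).
rewrite (_ : (fun d => _) = (fun d : nat => (k`!)%:R * ('C(d.+1 + k, k))%:R /
   (d + j.+1)%:R ^+ k : rat^o)); last first.
  apply/funext => d; rewrite /delay ifT; last by lia.
  by rewrite addnS -addSn addnK.
elim: k => [|k IH].
  rewrite (_ : (fun d => _) = (fun=> 1 : rat^o)); first exact: cvg_cst.
  by apply/funext => d; rewrite bin0 fact0 expr0 mulr1 divr1.
have hj : (fun d : nat => 1 + (k.+1%:R - j%:R) * harmonic (d + j)%N : rat^o)
    @ \oo --> (1 : rat^o).
  have h0 : (fun d : nat => harmonic (d + j)%N : rat^o) @ \oo --> (0 : rat^o).
    by rewrite (cvg_shiftn j (harmonic : nat -> rat^o)); exact: cvg_harmonic.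
  have h1 : (fun d : nat => (k.+1%:R - j%:R) * harmonic (d + j)%N : rat^o)
      @ \oo --> ((k.+1%:R - j%:R) * 0 : rat^o) by exact: (@cvgMl_tmp rat).
  have h2 : (fun d : nat => 1 + (k.+1%:R - j%:R) * harmonic (d + j)%N : rat^o)
      @ \oo --> (1 + (k.+1%:R - j%:R) * 0 : rat^o).
    by apply: (@cvgD _ rat^o) => //; exact: cvg_cst.
  by rewrite mulr0 addr0 in h2.
have h3 : (fun d : nat => (k`!%:R * 'C(d.+1 + k, k)%:R / (d + j.+1)%:R ^+ k)
     * (1 + (k.+1%:R - j%:R) * harmonic (d + j)%N) : rat^o) @ \oo --> (1 * 1 : rat^o).
  exact: (@cvgM rat).
rewrite mulr1 in h3.
rewrite (_ : (fun d => _) = (fun d : nat => (k`!%:R * 'C(d.+1 + k, k)%:R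
   / (d + j.+1)%:R ^+ k) * (1 + (k.+1%:R - j%:R) * harmonic (d + j)%N) : rat^o)) //.
apply/funext => d /=; rewrite /harmonic /= -addnS.
have d0 : (d + j.+1)%:R != 0 :> rat by rewrite pnatr_eq0 addnS.
have E : (k.+1%:R * 'C(d.+1 + k.+1, k.+1)%:R
    = (d.+1 + k.+1)%:R * 'C(d.+1 + k, k)%:R :> rat).
  by rewrite -!natrM -mul_bin_diag addnS.
have -> : (k.+1)`!%:R * 'C(d.+1 + k.+1, k.+1)%:R
    = k`!%:R * ((d.+1 + k.+1)%:R * 'C(d.+1 + k, k)%:R) :> rat.
  by rewrite -E factS natrM; ring.
rewrite exprS invfM !natrD.
move: d0; rewrite !natrD => d0.
have -> : 1 + (k.+1%:R - j%:R) / (d%:R + j.+1%:R) =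
   (d.+1%:R + k.+1%:R) / (d%:R + j.+1%:R) :> rat.
  rewrite -[X in X + _](divff d0) -mulrDl; congr (_ / _).
  by rewrite -(natr1 d) -(natr1 j); ring.
by ring.
Qed.

Lemma growth_limit_sum k c : growth_limit k (delayed_sum k.+1 c) (size c)%:R.
Proof.
elim: c => [|j c IH].
  rewrite /growth_limit (_ : (fun d => _) = (fun=> 0 : rat^o)); first exact: cvg_cst.
  by apply/funext => d; rewrite /delayed_sum big_nil mulr0 mul0r.
rewrite [size _]/= -nat1r.
rewrite (_ : delayed_sum _ _ =
    fun d => delay j (monom_count k.+1) d + delayed_sum k.+1 c d)%N.
  exact: growth_limitD (growth_limit_delay k j) IH.
by apply/funext => d; rewrite /delayed_sum big_cons.
Qed.

End Limits.

(** * Counting monomials outside a monomial ideal *)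

Section MonomialCounts.
Variable s : nat.
Local Notation mon := 'X_{1..s}.
Implicit Types (A : seq mon) (a b c : mon).

Definition upset A : set mon := [set a | has (fun c => (c <= a)%MM) A].

Lemma mnm_le_sub a b c : (a <= b + c)%MM = (a - c <= b)%MM.
Proof.
apply/mnm_lepP/mnm_lepP => h i; have := h i; rewrite !(mnmDE, mnmBE); lia.
Qed.

Lemma degree_count_sub (M M' : set mon) d :
  M `<=` M' -> (degree_count M' d <= degree_count M d)%N.
Proof.
move=> MM'; apply: uniq_leq_size; first by rewrite filter_uniq ?mons_uniq.
move=> a; rewrite !mem_filter => /andP[/andP[-> M'a] ->]; rewrite andbT /=.
by apply: contra M'a => /asboolP/MM' /asboolP.
Qed.

(** The monomials divisible by c outside A are c times the monomials outside
    the colon A : c. *)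
Lemma count_cons (T : pred nat) m A c : (forall d, T d -> (d < m)%N) ->
  size [seq a <- mons s m | T (mdeg a) && ~~ `[< upset A a >]] =
  (size [seq a <- mons s m | T (mdeg a) && ~~ `[< upset (c :: A) a >]] +
   size [seq b <- mons s m | T (mdeg b + mdeg c)%N
            && ~~ `[< upset [seq a - c | a <- A]%MM b >]])%N.
Proof.
move=> Tm; set P := fun a => _ && ~~ `[< upset A a >].
rewrite -(count_predC (fun a => ~~ (c <= a)%MM)) -!size_filter -!filter_predI.
congr (_ + _)%N.
  congr size; apply: eq_filter => a; rewrite /P /= /upset /= !asboolb negb_or.
  by rewrite andbCA.
set L2 := [seq b <- _ | T (mdeg b + _)%N && _]; rewrite -(size_map (mnm_add^~ c) L2).
apply/perm_size/uniq_perm.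
- by rewrite filter_uniq ?mons_uniq.
- by rewrite map_inj_uniq ?filter_uniq ?mons_uniq //; exact: addIm.
move=> a; rewrite mem_filter mem_mons /= negbK /P /upset /= asboolb.
apply/idP/mapP => [/andP[/and3P[ca Ta Aa] am]|[b + ->]].
  exists (a - c)%MM; last by rewrite submK.
  rewrite mem_filter mem_mons -mdegD submK // Ta asboolb has_map.
  rewrite (leq_ltn_trans (mdegB _ _)) // andbT /=.
  by rewrite (eq_has (a2 := fun x => (x <= a)%MM)) // => x /=; rewrite -mnm_le_sub submK.
rewrite mem_filter -mdegD asboolb has_map => /andP[/andP[Tb Ab] _].
rewrite lem_addl Tb (Tm _ Tb) andbT /=.
by rewrite (eq_has (a2 := fun x => (x <= b + c)%MM)) // in Ab => x /=; rewrite mnm_le_sub.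
Qed.

Lemma degree_count_cons A c d : degree_count (upset A) d =
  (degree_count (upset (c :: A)) d
   + delay (mdeg c) (degree_count (upset [seq a - c | a <- A]%MM)) d)%N.
Proof.
rewrite /degree_count (@count_cons (pred1 d) d.+1 A c) => [|_ /eqP -> //].
congr (_ + _)%N; rewrite /delay; case: leqP => cd.
  apply/perm_size/uniq_perm; rewrite ?filter_uniq ?mons_uniq // => b.
  rewrite !mem_filter !mem_mons /= -[in LHS](subnK cd) eqn_add2r.
  by case: eqP => //= ->; congr (_ && _); lia.
apply/eqP; rewrite size_eq0 -[_ == _]negbK -has_filter; apply/hasPn => b _ /=.
by rewrite negb_and; apply/orP; left; lia.
Qed.

Lemma affine_count_cons A c n : affine_count (upset A) n =
  (affine_count (upset (c :: A)) n
   + affine_count (upset [seq a - c | a <- A]%MM) (n - mdeg c))%N.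
Proof.
have E M : affine_count M n =
    size [seq a <- mons s n | (mdeg a < n)%N && ~~ `[< M a >]].
  by congr size; apply: eq_in_filter => a; rewrite mem_mons => ->.
rewrite !E (@count_cons (fun d => d < n)%N n A c) //; congr (_ + _)%N.
apply/perm_size/uniq_perm; rewrite ?filter_uniq ?mons_uniq // => b.
rewrite !mem_filter !mem_mons ltn_subRL [(mdeg c + _)%N]addnC.
case: (ltnP (mdeg b + mdeg c)) => //= bc; last by rewrite andbF.
by rewrite (leq_ltn_trans (leq_addr _ _) bc).
Qed.

Definition disjoint_mons a b : bool := [forall v, (a v == 0%N) || (b v == 0%N)].

Lemma disjoint_monsB a b : disjoint_mons a b -> (b - a)%MM = b.
Proof. by move/forallP => ab; apply/mnmP => v; rewrite mnmBE; have := ab v; lia. Qed.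

Lemma degree_count_nil d : degree_count (upset [::]) d = monom_count s d.
Proof.
have E : degree_count (upset [::]) d = size [seq a <- mons s d.+1 | mdeg a == d].
  by congr size; apply: eq_filter => a; rewrite /upset /= asboolb andbT.
rewrite {}E; case: s => [|n].
  have e0 (a : 'X_{1..0}) : a = 0%MM by apply/mnmP => -[].
  case: d => [|d]; last first.
    apply/eqP; rewrite size_eq0 -[_ == _]negbK -has_filter; apply/hasPn => a _.
    by rewrite (e0 a) mdeg0.
  rewrite -[RHS]/(size [:: 0%MM : 'X_{1..0}]); apply/perm_size/uniq_perm => //.
    by rewrite filter_uniq ?mons_uniq.
  by move=> a; rewrite mem_filter mem_mons (e0 a) mdeg0 inE !eqxx.
have -> : monom_count n.+1 d = 'C(d + n, d) by rewrite /= -bin_sub ?leq_addl ?addnK.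
rewrite -(mpoly.size_basis n d); apply/perm_size/uniq_perm.
- by rewrite filter_uniq ?mons_uniq.
- exact: uniq_basis.
by move=> a; rewrite mem_filter mem_mons -basis_cover andb_idr // => /eqP ->.
Qed.

(** Each monomial coprime to the others multiplies the Hilbert series by
    1 - T ^ e, where e is its degree. *)
Lemma degree_count_disjoint A : pairwise disjoint_mons A -> (size A <= s)%N ->
  exists2 c, size c = (\prod_(a <- A) mdeg a)%N &
    forall d, degree_count (upset A) d = delayed_sum (s - size A) c d.
Proof.
elim: A => [|a A IH] /=.
  move=> _ _; exists [:: 0%N]; first by rewrite big_nil.
  move=> d; rewrite degree_count_nil /delayed_sum big_cons big_nil addn0 subn0.
  by rewrite /delay subn0.
move=> /andP[/allP aA dA] sA; have [c sc cE] := IH dA (ltnW sA).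
have [c' sc' c'E] := delayed_sum_step (s - (size A).+1) c (mdeg a).
exists c'; first by rewrite sc' sc big_cons mulnC.
move=> d; have e : (s - size A = (s - (size A).+1).+1)%N by lia.
have := degree_count_cons A a d; rewrite cE e c'E.
have -> : [seq (x - a)%MM | x <- A] = A.
  by apply: map_id_in => x xA; apply: disjoint_monsB; exact: aA.
rewrite (@eq_delay _ _ (delayed_sum (s - (size A).+1).+1 c)) => [|d']; last by rewrite cE e.
by move/eqP; rewrite addnC eqn_add2r => /eqP.
Qed.

End MonomialCounts.

(** * Lowering the factors of a product *)

Section Greedy.

(** Lowers the factors of the product of the D i, starting from the first one,
    down to 1 at most and by d in total. *)
Fixpoint greedy r : ('I_r -> nat) -> nat -> nat :=
  if r is r'.+1 then fun D d =>
    if (d < D ord0)%N then ((D ord0 - d) * \prod_(i < r') D (lift ord0 i))%N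
    else greedy (fun i => D (lift ord0 i)) (d - (D ord0 - 1))%N
  else fun _ _ => 1%N.

(** Lowering a factor by one unit costs the product of the other factors, which
    is most for the smallest factor t. *)
Lemma greedy_trade r (D : 'I_r -> nat) t u : (forall i, t <= D i)%N ->
  ((t - u) * \prod_i D i <= t * greedy D u)%N.
Proof.
case: r D => [|r] D tD /=; first by rewrite big_ord0 !muln1 leq_subr.
rewrite big_ord_recl; set P := (\prod_(i < r) _)%N; have := tD ord0.
case: ltnP => uD tD0; last by rewrite (_ : t - u = 0)%N ?mul0n //; lia.
by rewrite !mulnA leq_mul2r; apply/orP; right; nia.
Qed.

Lemma greedy_shift r (D : 'I_r -> nat) t y : (0 < t)%N -> (forall i, t <= D i)%N ->
  (greedy D y <= t * greedy D (y + t - 1))%N.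
Proof.
elim: r D y => [|r IH] D y t0 tD /=; first by rewrite muln1.
have tD0 := tD ord0; have tD' i := tD (lift ord0 i).
case: (ltnP y (D ord0)) => yD; last first.
  rewrite ifF; last by lia.
  rewrite (_ : y + t - 1 - (D ord0 - 1) = y - (D ord0 - 1) + t - 1)%N; last by lia.
  exact: IH.
case: ltnP => ytD.
  by rewrite mulnA leq_mul2r; apply/orP; right; nia.
apply: leq_trans (greedy_trade _ tD'); rewrite leq_mul2r; apply/orP; right; lia.
Qed.

(** Compared with the greedy choice, x lowers the smallest factor by less and
    leaves more units for the others.  Moving these units to the first factor,
    which stays below the others, does not increase the product: this is
    [greedy_trade] if the greedy choice spends everything on the first factor,
    and [greedy_shift] otherwise. *)
Lemma greedy_min r (D x : 'I_r -> nat) d :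
  (forall i j : 'I_r, (i <= j)%N -> (D i <= D j)%N) ->
  (forall i, 0 < x i <= D i)%N -> (\sum_i (D i - x i) <= d)%N ->
  (greedy D d <= \prod_i x i)%N.
Proof.
elim: r D x d => [|r IH] D x d mono xD; first by move=> _; rewrite big_ord0.
rewrite big_ord_recl => Dxd; rewrite [X in (_ <= X)%N]big_ord_recl.
have /andP[x0 xD0] := xD ord0.
have D0i i : (D ord0 <= D (lift ord0 i))%N by exact: mono.
have xDi i : (x ord0 <= D (lift ord0 i))%N by exact: leq_trans (D0i i).
have {}IH := IH (fun i => D (lift ord0 i)) (fun i => x (lift ord0 i))
  (d - (D ord0 - x ord0))%N.
apply: (@leq_trans (x ord0 * greedy (fun i => D (lift ord0 i)) (d - (D ord0 - x ord0)))%N);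
  last first.
  rewrite leq_mul2l; apply/orP; right; apply: IH => [i j ij|i|].
  - by apply: mono; rewrite !lift0.
  - exact: xD.
  - by rewrite leq_subRL ?Dxd // (leq_trans (leq_addr _ _) Dxd).
rewrite /=; case: ltnP => dD.
  apply: leq_trans (greedy_trade _ xDi); rewrite leq_mul2r; apply/orP; right; lia.
apply: leq_trans (greedy_shift _ x0 xDi) _.
rewrite leq_mul2l; apply/orP; right; apply: eq_leq; congr greedy; lia.
Qed.

Lemma greedy_attained r (D : 'I_r -> nat) d : (forall i, 0 < D i)%N ->
  exists x : 'I_r -> nat, [/\ forall i, (0 < x i <= D i)%N,
    \prod_i x i = greedy D d &
    \sum_i (D i - x i) = minn d (\sum_i (D i - 1))]%N.
Proof.
elim: r D d => [|r IH] D d D0.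
  by exists (fun=> 1%N); split=> [[]//||]; rewrite !big_ord0 ?minn0.
pose cons (x0 : nat) (x : 'I_r -> nat) (i : 'I_r.+1) :=
  if unlift ord0 i is Some j then x j else x0.
have cons0 x0 x : cons x0 x ord0 = x0 by rewrite /cons unlift_none.
have consS x0 x j : cons x0 x (lift ord0 j) = x j by rewrite /cons liftK.
have all_cons x0 x (P : 'I_r.+1 -> nat -> bool) : P ord0 x0 ->
    (forall j, P (lift ord0 j) (x j)) -> forall i, P i (cons x0 x i).
  by move=> P0 PS i; case: (unliftP ord0 i) => [j ->|->]; rewrite ?cons0 ?consS.
rewrite /=; case: ltnP => dD.
  exists (cons (D ord0 - d)%N (fun j => D (lift ord0 j))); split.
  - apply: (all_cons _ _ (fun i n => 0 < n <= D i)%N) => [|j]; last by rewrite D0 leqnn.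
    by rewrite leq_subr subn_gt0 dD.
  - by rewrite big_ord_recl cons0; congr (_ * _)%N; apply: eq_bigr => j _; rewrite consS.
  - rewrite !big_ord_recl cons0 big1 => [|j _]; last by rewrite consS subnn.
    lia.
have [x [xD xP xS]] := IH (fun i => D (lift ord0 i)) (d - (D ord0 - 1))%N (fun i => D0 _).
exists (cons 1%N x); split.
- by apply: (all_cons _ _ (fun i n => 0 < n <= D i)%N) => //=; rewrite D0.
- by rewrite big_ord_recl cons0 mul1n -xP; apply: eq_bigr => j _; rewrite consS.
- rewrite !big_ord_recl cons0.
  rewrite (eq_bigr (fun j => D (lift ord0 j) - x j)%N) => [|j _]; last by rewrite consS.
  by rewrite xS addn_minr subnKC // leq_subLR (leq_trans dD) ?leq_addl.
Qed.

Lemma greedy_decomp r (D : 'I_r -> nat) d (k : 'I_r) l :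
  d = (\sum_(i < r | (i < k)%N) (D i - 1) + l)%N -> (1 <= l <= D k - 1)%N ->
  greedy D d = ((D k - l) * \prod_(i < r | (k < i)%N) D i)%N.
Proof.
elim: r D d k => [|r IH] D d k; first by case: k.
case: (unliftP ord0 k) => [j ->|->] /=.
  rewrite big_mkcond big_ord_recl /= => dE lk.
  rewrite [in RHS]big_mkcond big_ord_recl /= mul1n.
  rewrite ifF; last by apply/negbTE; rewrite -leqNgt; lia.
  rewrite (IH _ (d - (D ord0 - 1))%N j) //.
    congr (_ * _)%N; rewrite big_mkcond; apply: eq_bigr => i _.
    by rewrite /bump !add1n ltnS.
  rewrite dE -addnA addKn; congr (_ + _)%N.
  by rewrite [in RHS]big_mkcond; apply: eq_bigr => i _; rewrite /bump !add1n ltnS.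
rewrite big_pred0 // => -> lk; rewrite add0n ifT; last by lia.
by congr (_ * _)%N; rewrite [in RHS]big_mkcond big_ord_recl /= mul1n.
Qed.

Lemma decomp_exists r (D : 'I_r -> nat) d : (0 < d <= \sum_i (D i - 1))%N ->
  exists (k : 'I_r) l,
    d = (\sum_(i < r | (i < k)%N) (D i - 1) + l)%N /\ (1 <= l <= D k - 1)%N.
Proof.
elim: r D d => [|r IH] D d; first by rewrite big_ord0; lia.
rewrite big_ord_recl => dD.
have [dD0|dD0] := leqP d (D ord0 - 1).
  by exists ord0, d; rewrite big_pred0 // add0n; split=> //; lia.
have [|k [l [dE lk]]] := IH (fun i => D (lift ord0 i)) (d - (D ord0 - 1))%N.
  by rewrite subn_gt0 dD0 leq_subLR; case/andP: dD.
exists (lift ord0 k), l; split=> //.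
rewrite big_mkcond big_ord_recl /=; rewrite big_mkcond in dE.
rewrite -addnA (eq_bigr (fun i : 'I_r => if (i < k)%N then D (lift ord0 i) - 1 else 0)%N).
  by rewrite -dE subnKC // ltnW.
by move=> i _; rewrite /bump !add1n ltnS.
Qed.

Lemma greedy_large r (D : 'I_r -> nat) d : (forall i, 0 < D i)%N ->
  (\sum_i (D i - 1) <= d)%N -> greedy D d = 1%N.
Proof.
elim: r D d => [//|r IH] D d D0; rewrite big_ord_recl /= => Dd.
case: ltnP => dD; last first.
  by apply: IH => //; rewrite leq_subRL // (leq_trans (leq_addr _ _) Dd).
have S0 : (\sum_(i < r) (D (lift ord0 i) - 1) == 0)%N.
  by rewrite -leqn0 -(leq_add2l (D ord0 - 1)) addn0 (leq_trans Dd) //; lia.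
have D1 i : D (lift ord0 i) = 1%N.
  move: S0; rewrite sum_nat_eq0 => /forallP/(_ i) /=; have := D0 (lift ord0 i); lia.
rewrite big1 => [|i _]; last exact: D1.
by have := leq_trans (leq_addr _ _) Dd; rewrite muln1; lia.
Qed.

End Greedy.

(** * Monomial ideals *)

Section MonomialIdeals.
Variables (K : fieldType) (s : nat).
Local Notation S := {mpoly K[s]}.
Local Notation mon := 'X_{1..s}.
Implicit Types (M : set mon) (a b : mon).

Definition monomial_ideal M : set S := [set f | forall a, a \in msupp f -> M a].

Lemma monomial_idealX M a : monomial_ideal M 'X_[a] <-> M a.
Proof.
split=> [|Ma b]; last by rewrite msuppX inE => /eqP ->.
by apply; rewrite msuppX inE.
Qed.

Lemma monomial_ideal_ideal M : up_closed M -> is_ideal (monomial_ideal M).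
Proof.
move=> uM; split=> [a|f g Mf Mg a /msuppD_le|h f Mf a /msuppM_le].
- by rewrite msupp0.
- by rewrite mem_cat => /orP[/Mf|/Mg].
- by move/allpairsP => [[u v] /= [_ vf ->]]; rewrite addmC; apply: uM; exact: Mf.
Qed.

Lemma monomial_ideal_graded M : graded (monomial_ideal M).
Proof. by move=> f Mf d a; rewrite mem_pihomog => /andP[_]; exact: Mf. Qed.

Lemma monomial_ideal_inj M M' : monomial_ideal M = monomial_ideal M' -> M = M'.
Proof.
by move=> E; apply/seteqP; split=> a; rewrite -!monomial_idealX E.
Qed.

Lemma ideal_gen_monomial M (G : set S) : up_closed M -> G `<=` monomial_ideal M ->
  (forall a, M a -> ideal_gen G 'X_[a]) -> ideal_gen G = monomial_ideal M.
Proof.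
move=> uM GM MG; apply/seteqP; split.
  by apply: ideal_genS => //; exact: monomial_ideal_ideal.
have sG := ideal_subspace (ideal_gen_ideal G); have [_ _ sZ] := sG.
move=> f Mf; rewrite (mpolyE f) big_seq; apply: (subspace_sum _ sG) => a /Mf Ma.
by apply: sZ; exact: MG.
Qed.

Lemma upset_up (A : seq mon) : up_closed (upset A).
Proof.
move=> a b /hasP[c cA ca]; apply/hasP; exists c => //.
exact: lepm_trans ca (lem_addr _ _).
Qed.

Lemma add_gen_monomial (A : seq mon) a :
  add_gen (monomial_ideal (upset A)) 'X_[a] = monomial_ideal (upset (a :: A)).
Proof.
have iA := monomial_ideal_ideal (@upset_up A).
apply: ideal_gen_monomial; first exact: upset_up.
  move=> f [Af b /Af|->]; first by rewrite /upset /= => ->; rewrite orbT.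
  by apply/monomial_idealX; rewrite /upset /= lepm_refl.
move=> b; rewrite /upset /= => /orP[ab|Ab]; last first.
  by apply: sub_ideal_gen; left; apply/monomial_idealX.
have [_ _ GM] := add_gen_ideal (monomial_ideal (upset A)) 'X_[a].
by rewrite -(submK ab) mpolyXD; apply: GM; apply: sub_ideal_gen; right.
Qed.

Section Order.
Variable le : rel mon.
Hypothesis hle : monomial_order le.

Lemma lead_mons_monomial M : lead_mons le (monomial_ideal M) = M.
Proof.
apply/seteqP; split=> [a [f Mf [af _]]|a Ma]; first exact: Mf.
by apply: (lead_monsX hle); apply/monomial_idealX.
Qed.

Lemma initial_idealE (I : set S) : is_ideal I ->
  initial_ideal le I = monomial_ideal (lead_mons le I).
Proof.
move=> iI; apply: ideal_gen_monomial; first exact: lead_mons_up.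
  by move=> _ [f [a [If fa ->]]]; apply/monomial_idealX; exists f.
by move=> a [f If fa]; apply: sub_ideal_gen; exists f, a.
Qed.

End Order.
End MonomialIdeals.

(** * Monomials with disjoint supports *)

Section DisjointFamilies.
Variables (s r : nat).
Local Notation mon := 'X_{1..s}.
Implicit Type c : 'I_r -> mon.

Definition disjoint_family c : Prop :=
  forall i j v, c i v != 0%N -> c j v != 0%N -> i = j.

Definition family_upset c : set mon := upset [seq c i | i <- enum 'I_r].

Lemma family_upsetP c a : family_upset c a <-> exists i, (c i <= a)%MM.
Proof.
split=> [/hasP[_ /mapP[i _ ->] ia]|[i ia]]; first by exists i.
by apply/hasP; exists (c i) => //; rewrite map_f ?mem_enum.
Qed.

Lemma mnm_neq0 (a : mon) : a != 0%MM -> exists v, a v != 0%N.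
Proof.
move=> a0; apply: contrapT => na; case/eqP: a0; apply/mnmP => v; rewrite mnm0E.
by apply/eqP/negPn/negP => av; apply: na; exists v.
Qed.

Lemma disjoint_transversal c : disjoint_family c -> (forall i, c i != 0%MM) ->
  exists2 v : 'I_r -> 'I_s, injective v & forall i, c i (v i) != 0%N.
Proof.
move=> dc c0; have [v vc] := choice (fun i => mnm_neq0 (c0 i)).
by exists v => // i j ij; apply: (dc i j (v i)); rewrite ?vc // ij vc.
Qed.

Lemma disjoint_family_size c : disjoint_family c -> (forall i, c i != 0%MM) -> (r <= s)%N.
Proof.
move=> dc /(disjoint_transversal dc)[v vinj _].
by rewrite -[r]card_ord -[X in (_ <= X)%N]card_ord -(card_imset _ vinj) max_card.
Qed.

Lemma free_transversal (v : 'I_r -> 'I_s) (M : set mon) : injective v ->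
  (forall a, M a -> exists i, a (v i) != 0%N) -> free_vars M (s - r).
Proof.
move=> vinj Mv; exists (~: (v @: 'I_r)).
  by rewrite cardsCs setCK card_imset // !card_ord.
by move=> a /Mv[i ai]; exists (v i); rewrite // inE negbK imset_f.
Qed.

Lemma family_free c : disjoint_family c -> (forall i, c i != 0%MM) ->
  free_vars (family_upset c) (s - r).
Proof.
move=> dc /(disjoint_transversal dc)[v vinj vc]; apply: (free_transversal vinj).
move=> a /family_upsetP[i /mnm_lepP ia]; exists i.
by rewrite -lt0n; apply: leq_trans (ia (v i)); rewrite lt0n.
Qed.

(** The complement of s - r + 1 variables has fewer than r elements, so it misses
    one of the r disjoint supports. *)
Lemma family_not_free c (M : set mon) : disjoint_family c -> (forall i, c i != 0%MM) ->
  family_upset c `<=` M -> ~ free_vars M (s - r).+1.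
Proof.
move=> dc c0 cM [B cB avB]; have rs := disjoint_family_size dc c0.
have ex i : exists v, v \notin B /\ c i v != 0%N.
  have [|v vB iv] := avB (c i); last by exists v.
  by apply: cM; apply/family_upsetP; exists i; exact: lepm_refl.
have [v vP] := choice ex.
have vinj : injective v.
  by move=> i j ij; apply: (dc i j (v i)); [|rewrite ij]; case: (vP i); case: (vP j).
have : (#|v @: 'I_r| <= #|~: B|)%N.
  by apply/subset_leq_card/subsetP => _ /imsetP[i _ ->]; rewrite inE; case: (vP i).
rewrite card_imset // card_ord cardsCs setCK card_ord cB.
by have := max_card (mem B); rewrite card_ord cB; lia.
Qed.

Lemma degree_count_family c : disjoint_family c -> (r <= s)%N ->
  exists2 l, size l = (\prod_i mdeg (c i))%N &
    forall d, degree_count (family_upset c) d = delayed_sum (s - r) l d.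
Proof.
move=> dc rs; have [||l sl lE] := @degree_count_disjoint s [seq c i | i <- enum 'I_r].
- rewrite pairwise_map; have := enum_uniq 'I_r; rewrite uniq_pairwise.
  apply: sub_pairwise => i j /= ij; apply/forallP => v; rewrite -[_ || _]negbK negb_or.
  by apply: contra ij => /andP[iv jv]; apply/eqP/(dc i j v).
- by rewrite size_map size_enum_ord.
exists l; first by rewrite sl big_map big_enum.
by move=> d; rewrite lE size_map size_enum_ord.
Qed.

Lemma disjoint_familyB c (a : mon) : disjoint_family c ->
  disjoint_family (fun i => (c i - a)%MM).
Proof. by move=> dc i j v; rewrite !mnmBE => iv jv; apply: (dc i j v); lia. Qed.

Lemma family_mapB c (a : mon) :
  [seq (x - a)%MM | x <- [seq c i | i <- enum 'I_r]] = [seq (c i - a)%MM | i <- enum 'I_r].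
Proof. by rewrite -map_comp. Qed.

(** The supports being disjoint, the parts of a that lie in them add up to a
    divisor of a. *)
Lemma sum_mdegB c (a : mon) : disjoint_family c ->
  (\sum_i (mdeg (c i) - mdeg (c i - a)%MM) <= mdeg a)%N.
Proof.
move=> dc.
have E i : (mdeg (c i) - mdeg (c i - a)%MM = \sum_v (c i v - (c i - a)%MM v))%N.
  by rewrite sumnB ?mdegE // => v _; rewrite mnmBE leq_subr.
under eq_bigr do rewrite E.
rewrite exchange_big mdegE; apply: leq_sum => v _.
have [[i iv]|nv] := pselect (exists i, c i v != 0%N); last first.
  rewrite big1 // => i _; suff -> : c i v = 0%N by [].
  by apply/eqP/negPn/negP => iv; apply: nv; exists i.
rewrite (bigD1 i) //= big1 ?addn0 => [|j ji]; first by rewrite mnmBE; lia.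
suff -> : c j v = 0%N by [].
by apply/eqP/negPn; apply: contra ji => jv; apply/eqP/(dc j i v).
Qed.

End DisjointFamilies.

Lemma exists_submon s (a : 'X_{1..s}) m : (m <= mdeg a)%N ->
  exists2 b, (b <= a)%MM & mdeg b = m.
Proof.
elim: m => [|m IH] ma.
  by exists 0%MM; rewrite ?mdeg0 //; apply/mnm_lepP => i; rewrite mnm0E.
have [b ba bm] := IH (ltnW ma).
have [|v] := @mnm_neq0 s (a - b)%MM.
  apply/negP => /eqP ab0; have := mdegD (a - b)%MM b; rewrite submK // ab0 mdeg0; lia.
rewrite mnmBE => abv; exists (b + U_(v))%MM; last by rewrite mdegD mdeg1 bm addn1.
apply/mnm_lepP => i; rewrite mnmDE mnm1E; have /mnm_lepP/(_ i) := ba.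
by case: (v =P i) => [<-|_]; lia.
Qed.

Lemma ideal_gen_family (K : fieldType) s r (c : 'I_r -> 'X_{1..s}) :
  ideal_gen (range (fun i => 'X_[c i] : {mpoly K[s]})) = monomial_ideal (family_upset c).
Proof.
apply: ideal_gen_monomial; first exact: upset_up.
  move=> _ [i _ <-]; apply/monomial_idealX/family_upsetP; exists i; exact: lepm_refl.
move=> a /family_upsetP[i ia].
have [_ _ GM] := ideal_gen_ideal (range (fun i => 'X_[c i] : {mpoly K[s]})).
by rewrite -(submK ia) mpolyXD; apply: GM; apply: sub_ideal_gen; exists i.
Qed.

(** * Degrees, footprint and minimum distance *)

Section CompleteIntersections.
Variables (K : fieldType) (s : nat) (I : set {mpoly K[s]}) (le : rel 'X_{1..s}).
Variables (r k : nat) (alpha : 'I_r -> 'X_{1..s}).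
Hypotheses (hI : is_ideal I) (hG : graded I) (hle : monomial_order le).
Hypotheses (dis : disjoint_family alpha) (alpha0 : forall i, alpha i != 0%MM).
Hypotheses (LmI : lead_mons le I = family_upset alpha) (ks : (s - r = k.+1)%N).
Local Notation S := {mpoly K[s]}.
Local Notation mon := 'X_{1..s}.
Local Notation gens := [seq alpha i | i <- enum 'I_r].
Implicit Types (a c : mon) (J : set S).

Let rs : (r <= s)%N := disjoint_family_size dis alpha0.

Lemma degree_eq J e : dim_quot J = k.+1 -> growth_limit k (hilbert J) e%:R -> degree J = e.
Proof.
move=> dJ he; rewrite /degree dJ; apply: xget_unique => // e' he'.
by apply/eqP; rewrite -(eqr_nat rat); apply/eqP; exact: growth_limit_unique he' he.
Qed.

(** Where the limit that defines the degree fails to exist, the default value 0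
    satisfies the bound as well. *)
Lemma degree_le J u e : dim_quot J = k.+1 -> (forall d, hilbert J d <= u d)%N ->
  growth_limit k u e%:R -> (degree J <= e)%N.
Proof.
move=> dJ hu ue; rewrite /degree dJ; case: xgetP => [e' _ he'|//].
by rewrite -(ler_nat rat); exact: growth_limit_le hu he' ue.
Qed.

Lemma dim_family (J : set S) : is_ideal J -> graded J ->
    family_upset alpha `<=` lead_mons le J ->
    free_vars (lead_mons le J) (s - r) -> dim_quot J = (s - r)%N.
Proof.
move=> iJ gJ sub fr; apply: (dim_quotE hle) => //.
exact: family_not_free sub.
Qed.

Lemma dim_I : dim_quot I = (s - r)%N.
Proof. by apply: dim_family; rewrite ?LmI //; exact: family_free. Qed.

Lemma initial_idealI : initial_ideal le I = @monomial_ideal K s (family_upset alpha).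
Proof. by rewrite (initial_idealE hle hI) LmI. Qed.

Local Notation total := (\prod_i mdeg (alpha i))%N.
Local Notation residual a := (\prod_i mdeg (alpha i - a)%MM)%N.

Lemma degree_I : degree I = total.
Proof.
apply: degree_eq; first by rewrite dim_I.
have [l <- lE] := degree_count_family dis rs.
rewrite (_ : hilbert I = delayed_sum k.+1 l); first exact: growth_limit_sum.
by apply/funext => d; rewrite (hilbert_count hle) // LmI lE ks.
Qed.

Lemma residual_le a : (residual a <= total)%N.
Proof. by apply: leq_prod => i _; exact: mdegB. Qed.

(** The colon of the initial ideal by a is generated by the alpha i - a, which
    again have disjoint supports, so its quotient has degree [residual a]. *)
Lemma limit_add a :
  growth_limit k (degree_count (upset (a :: gens))) (total - residual a)%:R.
Proof.
have [l sl lE] := degree_count_family dis rs.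
have [l' sl' l'E] := degree_count_family (@disjoint_familyB _ _ _ a dis) rs.
pose u' := delayed_sum k.+1 [seq (i + mdeg a)%N | i <- l'].
have E d : delay (mdeg a) (degree_count (upset [seq x - a | x <- gens]%MM)) d = u' d.
  by rewrite family_mapB /u' -delayed_sum_delay; apply: eq_delay => d'; rewrite -ks -l'E.
have F d := degree_count_cons gens a d.
rewrite natrB ?residual_le // -sl -sl' -(size_map (addn^~ (mdeg a)) l').
rewrite (_ : degree_count _ = fun d => delayed_sum k.+1 l d - u' d)%N.
  apply: growth_limitB; [|exact: growth_limit_sum|exact: growth_limit_sum].
  by move=> d; rewrite -ks -lE F E leq_addl.
by apply/funext => d; rewrite -ks -lE F E addnK.
Qed.

Definition meets a : Prop := exists i v, alpha i v != 0%N /\ a v != 0%N.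

Lemma transversal_inj (v : 'I_r -> 'I_s) : (forall i, alpha i (v i) != 0%N) -> injective v.
Proof. by move=> vP i j ij; apply: (dis (v := v i)); rewrite ?vP // ij vP. Qed.

(** The variables outside a transversal of the supports are free modulo the
    generators; they are also free modulo a if the transversal contains a
    variable that a shares with some generator. *)
Lemma free_add a : meets a -> free_vars (upset (a :: gens)) (s - r).
Proof.
move=> [i0 [v0 [iv0 av0]]]; have [v _ vP] := disjoint_transversal dis alpha0.
pose v' i := if i == i0 then v0 else v i.
have v'P i : alpha i (v' i) != 0%N by rewrite /v'; case: (i =P i0) => [->|_].
apply: (free_transversal (transversal_inj v'P)) => b.
rewrite /upset /= => /orP[/mnm_lepP ab|/hasP[_ /mapP[i _ ->] /mnm_lepP ib]].
  exists i0; rewrite /v' eqxx -lt0n; apply: leq_trans (ab v0); by rewrite lt0n.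
by exists i; rewrite -lt0n; apply: leq_trans (ib _); rewrite lt0n.
Qed.

Lemma degree_add a : meets a ->
  degree (add_gen (initial_ideal le I) 'X_[a]) = (total - residual a)%N.
Proof.
move=> ma; rewrite initial_idealI add_gen_monomial.
have iJ := @monomial_ideal_ideal K s _ (@upset_up s (a :: gens)).
have gJ := @monomial_ideal_graded K s (upset (a :: gens)).
apply: degree_eq.
  rewrite -ks; apply: dim_family; rewrite ?(@lead_mons_monomial K s le hle) //.
    by move=> b; rewrite /family_upset /upset /= => ->; rewrite orbT.
  exact: free_add.
rewrite (_ : hilbert _ = degree_count (upset (a :: gens))); first exact: limit_add.
by apply/funext => d; rewrite (hilbert_count hle) // lead_mons_monomial.
Qed.

Lemma not_meets a b : ~ meets a -> family_upset alpha (b + a)%MM -> family_upset alpha b.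
Proof.
move=> na /family_upsetP[i /mnm_lepP ib]; apply/family_upsetP; exists i.
apply/mnm_lepP => v; have := ib v; rewrite mnmDE.
have [->//|iv] := eqVneq (alpha i v) 0%N; have [->|av] := eqVneq (a v) 0%N.
  by rewrite addn0.
by case: na; exists i, v.
Qed.

(** If a meets alpha i, then alpha i - a is an element of the colon by a that is
    not in the initial ideal. *)
Lemma zero_div_monomialsP d a : zero_div_monomials le I d a <->
  [/\ mdeg a = d, ~ family_upset alpha a & meets a].
Proof.
rewrite /zero_div_monomials /= initial_idealI.
have iJ := @monomial_ideal_ideal K s _ (@upset_up s gens).
split=> [[ad na ca]|[ad na [i [v [iv av]]]]].
  split=> //; first by move=> ua; apply: na; apply/monomial_idealX.
  apply: contrapT => nm; apply: ca; apply/seteqP; split; last exact: sub_colon.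
  move=> h hX b bh; apply: (not_meets nm); apply: hX.
  by rewrite mcoeff_msupp addmC mcoeffMX -mcoeff_msupp.
split=> //; first by move/monomial_idealX.
move=> ca; have: @monomial_ideal K s (family_upset alpha) 'X_[(alpha i - a)].
  rewrite -ca /colon /= -mpolyXD; apply/monomial_idealX/family_upsetP; exists i.
  by apply/mnm_lepP => w; rewrite mnmDE mnmBE; lia.
move=> /monomial_idealX/family_upsetP[j /mnm_lepP ji].
have [w jw] := mnm_neq0 (alpha0 j).
have ij : j = i.
  apply: (dis jw); have := ji w; rewrite mnmBE; move: jw; rewrite -!lt0n => jw h.
  by apply: leq_trans jw (leq_trans h (leq_subr _ _)).
have := ji v; rewrite ij mnmBE; lia.
Qed.

(** Reducing modulo I a form f and a witness h that it divides zero gives two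
    monomials outside the initial ideal with product in it. *)
Lemma zero_div_lead d (f : S) : zero_div_forms I d f -> exists a c,
  [/\ zero_div_monomials le I d a, lead_mons le (add_gen I f) a,
      lead_mons le (colon I f) c & ~ family_upset alpha c].
Proof.
move=> [fd nIf cf]; have sI := ideal_subspace hI; have [I0 ID IM] := hI.
pose T := [seq a <- mons s d.+1 | mdeg a == d].
have memT a : (a \in T) = (mdeg a == d).
  by rewrite mem_filter mem_mons andb_idr // => /eqP ->.
have fT : {subset msupp f <= T}.
  by move=> a af; rewrite memT; move/dhomogP: fd => /(_ a af) ->.
have [f' [f'T If']] := standard_span hle sI fT.
have f'0 : f' != 0 by apply/eqP => f'0; apply: nIf; rewrite f'0 subr0 in If'.
have [a fa] := exists_lead hle f'0.
have ad : mdeg a = d.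
  by have := f'T a fa.1; rewrite mem_filter memT => /andP[_ /eqP].
have na : ~ lead_mons le I a.
  move=> la; have := f'T a fa.1; rewrite mem_filter => /andP[/asboolP + _]; apply.
  by apply: (graded_lead_in hG _ la) => b ba; rewrite memT ba ad.
have [h [hc nIh]] : exists h, colon I f h /\ ~ I h.
  apply: contrapT => nh; apply: cf; apply/seteqP; split; last exact: sub_colon.
  by move=> h hc; apply: contrapT => nIh; apply: nh; exists h.
have hT : {subset msupp h <= mons s (msize h)}.
  by move=> b /msize_mdeg_lt; rewrite mem_mons.
have [h' [h'T Ih']] := standard_span hle sI hT.
have h'0 : h' != 0 by apply/eqP => h'0; apply: nIh; rewrite h'0 subr0 in Ih'.
have [c hc'] := exists_lead hle h'0.
have nc : ~ lead_mons le I c.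
  move=> lc; have := h'T c hc'.1; rewrite standard_mons // mem_filter => /andP[/asboolP].
  by move=> + _; apply.
have colh' : colon I f h'.
  have -> : h' = h - (h - h') by ring.
  apply: (subspaceB (ideal_subspace (colon_ideal f hI)) hc); exact: sub_colon.
have Ihf : I (h' * f').
  have -> : h' * f' = h' * f - h' * (f - f') by ring.
  by apply: subspaceB => //; exact: IM.
rewrite LmI in na nc.
exists a, c; split=> //; last by exists h'.
  apply/zero_div_monomialsP; split=> //; apply: contrapT => nm; apply: nc.
  apply: (not_meets nm); rewrite -LmI; exists (h' * f') => //; exact: is_leadM.
exists f' => //; apply/add_genP => //; exists (f' - f), 1; split; last by ring.
by have := subspaceB sI I0 If'; rewrite sub0r opprB.
Qed.

(** The dimension does not drop modulo a form f dividing zero.  The ideal (I : f)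
    has a leading monomial c outside in(I), so that the Hilbert function of
    (I, f), the difference of those of I and (I : f), is up to a shift at least
    that of the colon of in(I) by c, which has the same dimension as in(I). *)
Lemma free_forms d (f : S) : zero_div_forms I d f ->
  free_vars (lead_mons le (add_gen I f)) (s - r).
Proof.
move=> zf; have [a [c [_ _ lc nc]]] := zero_div_lead zf; have [fd _ _] := zf.
apply: contrapT => nfree; have [C HC] := free_growth hle (add_gen_ideal I f) nfree.
have fc : free_vars (family_upset (fun i => alpha i - c)%MM) (s - r).
  apply: family_free; first exact: disjoint_familyB.
  move=> i; apply/eqP => ic; apply: nc; apply/family_upsetP; exists i.
  apply/mnm_lepP => v; have /mnmP/(_ v) := ic; rewrite mnmBE mnm0E; lia.
have lower n : (affine_count (family_upset (fun i => alpha i - c)%MM) (n - mdeg c)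
    <= affine_count (lead_mons le (add_gen I f)) (n + d))%N.
  have h1 := affine_count_cons gens c n; rewrite family_mapB in h1.
  have h2 := affine_count_subadd hle n hI hG fd; rewrite LmI in h2.
  have h3 := affine_count_le (family_upset alpha) (leq_addr d n).
  have h4 : (affine_count (lead_mons le (colon I f)) n
             <= affine_count (upset (c :: gens)) n)%N.
    apply: affine_count_sub => b; rewrite /upset /= => /orP[cb|ub].
      rewrite -(submK cb) addmC; apply: (lead_mons_up hle) => //; exact: colon_ideal.
    by apply: (lead_mons_sub (sub_colon f hI)); rewrite LmI.
  rewrite /family_upset in h1 h2 h3 *; lia.
suff : (s - r < s - r)%N by rewrite ltnn.
apply: (@growth_lt _ (s - r) (s - r) (s + mdeg c + d) C _ HC) => n n0.
apply: leq_trans (free_vars_count fc n0) _.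
rewrite -[X in affine_count _ X](addnK (mdeg c)).
apply: leq_trans (lower _) _; apply: affine_count_le; nia.
Qed.

Lemma degree_forms d (f : S) : zero_div_forms I d f ->
  exists2 a, zero_div_monomials le I d a &
    (degree (add_gen I f) <= total - residual a)%N.
Proof.
move=> zf; have [a [c [za la _ _]]] := zero_div_lead zf; have [fd _ _] := zf.
exists a => //.
have iA := add_gen_ideal I f; have gA := add_gen_graded hI hG fd.
have subI : family_upset alpha `<=` lead_mons le (add_gen I f).
  by rewrite -LmI; apply: lead_mons_sub => x Ix; apply: sub_ideal_gen; left.
apply: degree_le (@limit_add a).
  by rewrite -ks; apply: dim_family => //; exact: free_forms zf.
move=> n; rewrite (hilbert_count hle) //; apply: degree_count_sub => b.
rewrite /upset /= => /orP[ab|/subI //].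
by rewrite -(submK ab) addmC; exact: (lead_mons_up hle).
Qed.

Local Notation D := (fun i => mdeg (alpha i)).
Hypothesis mono : forall i j : 'I_r, (i <= j)%N -> (D i <= D j)%N.

Let D0 i : (0 < D i)%N. Proof. by rewrite lt0n mdeg_eq0. Qed.

Lemma greedy_residual d a : zero_div_monomials le I d a -> (greedy D d <= residual a)%N.
Proof.
move=> /zero_div_monomialsP[ad na _]; apply: greedy_min => [//|i|].
  rewrite mdegB andbT lt0n mdeg_eq0; apply/eqP => ia; apply: na.
  apply/family_upsetP; exists i; apply/mnm_lepP => v.
  by have /mnmP/(_ v) := ia; rewrite mnmBE mnm0E; lia.
by rewrite -ad; exact: sum_mdegB.
Qed.

(** The monomial is the product of divisors of degree D i - x i of the alpha i,
    chosen so that a variable v i of each alpha i stays below its exponent there.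
    What is missing to the degree d is a power of a variable outside the
    transversal v, which exists as r < s: it can only lower the residual. *)
Lemma residual_attained d : (0 < d)%N -> (exists i, 1 < D i)%N ->
  exists2 a, zero_div_monomials le I d a & (residual a <= greedy D d)%N.
Proof.
move=> d0 [i1 Di1]; have [x [xD <- xS]] := greedy_attained d D0.
have [v vinj vP] := disjoint_transversal dis alpha0.
have [w wv] : exists w, w \notin v @: 'I_r.
  have : (0 < #|~: (v @: 'I_r)|)%N by rewrite cardsCs setCK card_imset // !card_ord ks.
  by rewrite card_gt0 => /set0Pn[w]; rewrite inE; exists w.
have Uv i : (U_(v i) <= alpha i)%MM by rewrite lep1mP.
have exb i : exists b, (b <= alpha i - U_(v i))%MM /\ mdeg b = (D i - x i)%N.
  have [|b] := @exists_submon s (alpha i - U_(v i))%MM (D i - x i); last by exists b.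
  have := mdegD (alpha i - U_(v i)) U_(v i); rewrite submK // mdeg1 => ->.
  by rewrite addn1; have /andP[] := xD i; lia.
have [b bP] := choice exb.
have ba i : (b i <= alpha i)%MM by case: (bP i) => /lepm_trans + _; apply; exact: lem_subr.
pose a := (\sum_i b i + U_(w) *+ (d - \sum_i (D i - x i))%N)%MM.
have aE u : a u = (\sum_i b i u + (w == u) * (d - \sum_i (D i - x i)))%N.
  by rewrite /a mnmDE mnm_sumE mulmnE mnm1E.
have bav i u : (b i u <= a u)%N by rewrite aE (bigD1 i) //= -addnA leq_addr.
exists a; last first.
  apply: leq_prod => i _; apply: (@leq_trans (mdeg (alpha i - b i)%MM)).
    by rewrite !mdegE; apply: leq_sum => u _; rewrite !mnmBE leq_sub2l.
  have := mdegD (alpha i - b i) (b i); rewrite submK // (proj2 (bP i)).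
  by have /andP[] := xD i; lia.
have eS : (\sum_i (D i - x i) <= d)%N by rewrite xS geq_minl.
apply/zero_div_monomialsP; split.
- rewrite /a mdegD mdeg_sum mdegMn mdeg1 mul1n.
  by rewrite (eq_bigr (fun i => D i - x i)%N) ?subnKC // => i _; case: (bP i).
- move=> /family_upsetP[i /mnm_lepP/(_ (v i))]; rewrite aE (bigD1 i) //= big1.
    have -> : (w == v i) = false.
      by apply/negP => /eqP wi; case/negP: wv; rewrite wi imset_f.
    have /mnm_lepP/(_ (v i)) := proj1 (bP i); rewrite mnmBE mnm1E eqxx.
    by have := vP i; lia.
  move=> j ji; have /mnm_lepP/(_ (v i)) := ba j.
  suff -> : alpha j (v i) = 0%N by rewrite leqn0 => /eqP.
  by apply/eqP/negPn; apply: contra ji => jv; apply/eqP/(dis jv).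
have [i xi] : exists i, (x i < D i)%N.
  apply: contrapT => nx; have S0 : (\sum_i (D i - x i) = 0)%N.
    rewrite big1 // => i _; apply/eqP; rewrite subn_eq0 leqNgt; apply/negP => xi.
    by apply: nx; exists i.
  have : (0 < \sum_i (D i - 1))%N by rewrite (bigD1 i1) //= addn_gt0 subn_gt0 Di1.
  by move: xS; rewrite S0 /minn; case: ifP; lia.
have [|u bu] := @mnm_neq0 s (b i).
  by rewrite -mdeg_eq0 (proj2 (bP i)) subn_eq0 -ltnNge.
exists i, u; split; rewrite -lt0n; rewrite -lt0n in bu; apply: leq_trans bu _.
  by have /mnm_lepP := ba i; apply.
exact: bav.
Qed.

Lemma greedy_le_total d : (greedy D d <= total)%N.
Proof.
by apply: greedy_min => [//|i|]; rewrite ?D0 ?leqnn // big1 // => i _; rewrite subnn.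
Qed.

Lemma greedy_gt0 d : (0 < greedy D d)%N.
Proof.
by have [x [xD <- _]] := greedy_attained d D0; rewrite prodn_gt0 // => i; case/andP: (xD i).
Qed.

Lemma footprint_greedy d : (0 < d)%N -> footprint le I d = (greedy D d)%:Z.
Proof.
move=> d0; rewrite /footprint degree_I; case: eqP => [Z0|/eqP/set0P[a0 za0]].
  (* By [residual_attained] all generators are then variables. *)
  congr Posz; have D1 i : D i = 1%N.
    apply/eqP; rewrite eqn_leq D0 andbT leqNgt; apply/negP => Di.
    have [|a za _] := @residual_attained d d0; first by exists i.
    by rewrite Z0 in za.
  by rewrite big1 // greedy_large // big1 // => i _; rewrite D1.
have meet a : zero_div_monomials le I d a -> meets a by case/zero_div_monomialsP.
have [|a za ag] := @residual_attained d d0.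
  have [_ na [i [v [iv av]]]] := proj1 (zero_div_monomialsP d a0) za0.
  exists i; rewrite ltn_neqAle D0 andbT; apply/eqP => Di; apply: na.
  apply/family_upsetP; exists i.
  have /mdeg1P[w /eqP iw] : mdeg (alpha i) == 1%N by rewrite -Di.
  rewrite iw lep1mP; move: iv; rewrite iw mnm1E; case: (w =P v) => [->|] //.
rewrite (@supremum_max _ (total - greedy D d)%N).
- by rewrite subzn ?leq_subr // subKn // greedy_le_total.
- exists a => //; rewrite degree_add; last exact: meet.
  by congr (_ - _)%N; apply/eqP; rewrite eqn_leq ag greedy_residual.
- move=> _ [b zb <-]; rewrite degree_add; last exact: meet.
  by rewrite leq_sub2l // greedy_residual.
Qed.

Lemma min_dist_greedy d : (greedy D d)%:Z <= min_dist I d.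
Proof.
rewrite /min_dist degree_I; case: eqP => _; first by rewrite lez_nat greedy_le_total.
have : (supremum 0%N [set degree (add_gen I f) | f in zero_div_forms I d]
        <= total - greedy D d)%N.
  apply: supremum_le => _ [f zf <-]; have [a za fa] := degree_forms zf.
  by apply: leq_trans fa _; rewrite leq_sub2l // greedy_residual.
by have := greedy_le_total d; lia.
Qed.

End CompleteIntersections.

(** * The footprint function *)

(* Indices start at 0: deg i is d_{i+1}. *)
Theorem theorem5p6 (K : fieldType) (s : nat) (I : set {mpoly K[s]})
    (le : rel 'X_{1..s}) (r : nat) (alpha : 'I_r -> 'X_{1..s})
    (hI : is_ideal I) (hgraded : graded I) (hnz : I <> [set 0])
    (hdim : (1 <= dim_quot I)%N) (hle : monomial_order le)
    (hci : complete_intersection (initial_ideal le I))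
    (hht : height (initial_ideal le I) = r)
    (hgen : initial_ideal le I = ideal_gen (range (fun i => 'X_[alpha i])))
    (hpos : forall i, (1 <= mdeg (alpha i))%N)
    (hmono : forall i j : 'I_r, (i <= j)%N ->
               (mdeg (alpha i) <= mdeg (alpha j))%N) :
  let deg (i : 'I_r) : nat := mdeg (alpha i) in
  let decomp (d : nat) (k : 'I_r) (l : nat) : Prop :=
    d = (\sum_(i < r | (i < k)%N) (deg i - 1) + l)%N /\
    (1 <= l <= deg k - 1)%N in
  [/\ forall d : nat, (1 <= d)%N ->
        min_dist I d >= footprint le I d /\ footprint le I d >= 1,
      forall d : nat, (1 <= d <= \sum_(i < r) (deg i - 1) - 1)%N ->
        (exists (k : 'I_r) (l : nat), decomp d k l) /\
        forall (k : 'I_r) (l : nat), decomp d k l ->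
          footprint le I d =
          ((deg k)%:Z - l%:Z) * \prod_(i < r | (k < i)%N) (deg i)%:Z
    & forall d : nat, (1 <= d)%N -> (d >= \sum_(i < r) (deg i - 1))%N ->
        footprint le I d = 1].
Proof.
move=> deg decomp.
have alpha0 i : alpha i != 0%MM by rewrite -mdeg_eq0 -lt0n.
have dis : disjoint_family alpha := disjoint_supports hle hgen hht hpos.
have LmI : lead_mons le I = family_upset alpha.
  apply: (@monomial_ideal_inj K).
  by rewrite -initial_idealE // hgen ideal_gen_family.
have ks : (s - r = (s - r).-1.+1)%N.
  by rewrite prednK // -(dim_I hI hgraded hle dis alpha0 LmI).
have fpE d : (0 < d)%N -> footprint le I d = (greedy deg d)%:Z.
  exact: (footprint_greedy hI hgraded hle dis alpha0 LmI ks hmono).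
split.
- move=> d d0; rewrite fpE //; split; last by rewrite lez_nat; exact: greedy_gt0.
  exact: (min_dist_greedy hI hgraded hle dis alpha0 LmI ks hmono).
- move=> d /andP[d0 dS]; split.
    by apply: decomp_exists; rewrite d0 (leq_trans dS) ?leq_subr.
  move=> k l [dE lk]; rewrite fpE // (greedy_decomp dE lk) PoszM.
  by rewrite subzn ?(big_morph Posz PoszM (erefl _)) //; lia.
- by move=> d d0 dS; rewrite fpE // greedy_large // => i; exact: hpos.
Qed.
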